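(* There is a compact set $A\subset\mathbb{R}^2$ with the following properties: (i) $A\in R(w,\rho,\delta;1)$; (ii) $\dim_{\mathcal H}A=1$; (iii) $A$ has neither weakly nor strongly locally finite $\mathcal H^1$-measure; (iv) $A$ is not $\mathcal H^1$-$\sigma$-finite; and (v) $A$ is purely countably $1$-unrectifiable.
   Context: $B_r(x)$ is the open ball and $L^r=\{x: d(x,L)<r\}$. $\mathcal H^1$ is one-dimensional Hausdorff measure and $\dim_{\mathcal H}$ is Hausdorff dimension. $A\in R(w,\rho,\delta;1)$ means: for every $\gamma\in(0,1)$ and every $y\in A$ there is $\rho_y>0$ (which may depend on $\gamma$) such that for all $\rho\in(0,\rho_y]$ and all $x\in B_{\rho_y}(y)\cap A$ there is an affine line $L_{x,\rho}$ through $x$ with $B_\rho(x)\cap A\subset L_{x,\rho}^{\gamma\rho}$. $A\subset\mathbb{R}^2$ has strongly locally finite $\mathcal H^1$-measure if $\mathcal H^1(K\cap A)<\infty$ for every compact $K\subset\mathbb{R}^2$; it has weakly locally finite $\mathcal H^1$-measure if for each $y\in A$ there is $\rho_y>0$ with $\mathcal H^1(B_{\rho_y}(y)\cap A)<\infty$. $A$ is $\mathcal H^1$-$\sigma$-finite if $A=\bigcup_{i=1}^\infty A_i$ with $\mathcal H^1(A_i)<\infty$ for each $i$. A set $F$ is (countably) $1$-rectifiable if $F\subset M_0\cup\bigcup_{i=1}^\infty f_i(\mathbb{R})$ with $\mathcal H^1(M_0)=0$ and $f_i:\mathbb{R}\to\mathbb{R}^2$ Lipschitz. $A$ is purely countably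 $1$-unrectifiable if $\mathcal H^1(F)=0$ for every $1$-rectifiable subset $F\subset A$. *)

(* Defs.v *)
From HB Require Import structures.
From mathcomp Require Import all_boot all_order all_algebra.
From mathcomp Require Import all_classical all_reals all_analysis.
Import Order.TTheory GRing.Theory Num.Theory.
Import numFieldNormedType.Exports.

Set Implicit Arguments.
Unset Strict Implicit.
Unset Printing Implicit Defensive.

Local Open Scope classical_set_scope.
Local Open Scope ring_scope.

(* The library norm on [R * R] is the sup norm.  Every metric notion below uses
   the Euclidean distance instead; only compactness is taken from the library's
   product topology on [R * R], which is the Euclidean topology. *)

Definition edist (R : realType) (p q : R * R) : R :=
  Num.sqrt ((p.1 - q.1) ^+ 2 + (p.2 - q.2) ^+ 2).

Definition eball (R : realType) (x : R * R) (r : R) : set (R * R) :=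
  [set y | edist x y < r].

(* Extended-real valued, so that the distance to the empty set is [+oo]. *)
Definition dist_to_set (R : realType) (x : R * R) (L : set (R * R)) : \bar R :=
  ereal_inf [set (edist x p)%:E | p in L].

Definition set_nbhd (R : realType) (L : set (R * R)) (r : R) : set (R * R) :=
  [set x | (dist_to_set x L < r%:E)%E].

Definition affine_line (R : realType) (L : set (R * R)) : Prop :=
  exists p v : R * R, v <> 0 /\ L = range (fun t : R => p + t *: v).

(* The added [0] makes the diameter of the empty set [0] rather than [-oo]. *)
Definition ediam (R : realType) (U : set (R * R)) : \bar R :=
  ereal_sup (0%E |` [set (edist p q)%:E | p in U & q in U]).

(* The case distinction fixes [0 ^ 0] for [s = 0]: empty sets contribute 0 and
   points contribute 1, so that the measure of exponent 0 is counting measure. *)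
Definition hausdorff_gauge (R : realType) (s : R) (U : set (R * R)) : \bar R :=
  if U == set0 then 0%E else (ediam U `^ s)%E.

Definition hausdorff_pre (R : realType) (s d : R) (A : set (R * R)) : \bar R :=
  ereal_inf [set (\sum_(0 <= i <oo) hausdorff_gauge s (U i))%E |
    U in [set U : nat -> set (R * R) |
           A `<=` \bigcup_i U i /\ forall i, (ediam (U i) <= d%:E)%E]].

(* Normalised without a dimensional constant; for [s = 1] the usual constant
   (volume of the unit ball over [2 ^ s]) equals 1 anyway. *)
Definition hausdorff_measure (R : realType) (s : R) (A : set (R * R)) : \bar R :=
  ereal_sup [set hausdorff_pre s d A | d in [set d : R | 0 < d]].

Definition hausdorff_dim (R : realType) (A : set (R * R)) : \bar R :=
  ereal_inf [set s%:E | s in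
    [set s : R | 0 <= s /\ hausdorff_measure s A = 0%E]].

Definition R_w_rho_delta_1 (R : realType) (A : set (R * R)) : Prop :=
  forall gamma : R, 0 < gamma < 1 ->
  forall y, A y ->
  exists rho_y : R, 0 < rho_y /\
    forall rho : R, 0 < rho <= rho_y ->
    forall x, (eball y rho_y `&` A) x ->
    exists L : set (R * R), [/\ affine_line L, L x &
      eball x rho `&` A `<=` set_nbhd L (gamma * rho)].

Definition strongly_locally_finite (R : realType) (A : set (R * R)) : Prop :=
  forall K : set (R * R), compact K -> (hausdorff_measure 1 (K `&` A) < +oo)%E.

Definition weakly_locally_finite (R : realType) (A : set (R * R)) : Prop :=
  forall y, A y -> exists rho_y : R,
    0 < rho_y /\ (hausdorff_measure 1 (eball y rho_y `&` A) < +oo)%E.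

Definition H1_sigma_finite (R : realType) (A : set (R * R)) : Prop :=
  exists A_ : nat -> set (R * R),
    A = \bigcup_i A_ i /\ forall i, (hausdorff_measure 1 (A_ i) < +oo)%E.

Definition elipschitz (R : realType) (f : R -> R * R) : Prop :=
  exists k : R, forall s t : R, edist (f s) (f t) <= k * `|s - t|.

Definition rectifiable1 (R : realType) (F : set (R * R)) : Prop :=
  exists (M0 : set (R * R)) (f : nat -> R -> R * R),
    [/\ hausdorff_measure 1 M0 = 0%E,
        forall i, elipschitz (f i) &
        F `<=` M0 `|` \bigcup_i range (f i)].

Definition purely_unrectifiable1 (R : realType) (A : set (R * R)) : Prop :=
  forall F : set (R * R), F `<=` A -> rectifiable1 F ->
    hausdorff_measure 1 F = 0%E.

(* Main.v *)
From HB Require Import structures.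
From mathcomp Require Import all_boot all_order all_algebra.
From mathcomp Require Import ring lra zify.
From mathcomp Require Import all_classical all_reals all_analysis.
Require Import Defs.
Import Order.TTheory GRing.Theory Num.Theory.
Import numFieldNormedType.Exports.

Set Implicit Arguments.
Unset Strict Implicit.
Unset Printing Implicit Defensive.

Local Open Scope classical_set_scope.
Local Open Scope ring_scope.

(** The set is a Koch snowflake whose angles tend to zero and whose pieces are
    sometimes shrunk away from each other.

    At level k a segment is replaced by the four segments of a Koch generator
    of small slope t_k, and then each of the four is shrunk about its midpoint
    by a factor s_k equal to 1 or 1/2.  All pieces of one level have the same
    length, and the generator multiplies total length by 1 + t_k^2.  We let t_k
    tend to 0 with divergent sum of squares, and take s_k = 1/2 infinitely
    often, but so rarely that the total length P_k of level k still tends to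
    infinity.

    Flatness: pieces lie in thin diamonds around their segments, and distinct
    children of one piece are ordered along it up to an angle O(t_k)
    ([step_lt]).  If k is the first level at which a small ball meets several
    children of a piece, the ball sees the set within O(t_k) times its radius
    of a line parallel to that piece.  The levels with s_k = 1/2 force k to be
    large for small balls ([trace_close_agree]), and t_k tends to 0; this is
    [snowflake_flat].  Without those gaps the corners of the early levels would
    survive at all scales.

    Length: the uniform distribution of mass on the pieces gives each piece of
    level k mass 4^-k, while its length is P_k 4^-k.  Hence the parametrization
    by base-4 expansions has, at small distances, an inverse with arbitrarily
    small Lipschitz constant ([digits_expand]).  It carries subsets of finite
    length to Lebesgue null sets, so countably many of them cannot exhaust the
    set ([flat_parametrization_not_sigma_finite]).  In particular the set has
    infinite length, hence dimension at least 1, and by compactness it has no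
    locally finite length.  As P_k grows at most linearly, the covers by the
    4^k pieces of level k show that the dimension is at most 1.

    Unrectifiability: at each level with s_k = 1/2, the set splits into
    clusters of diameter at most 8 l which are l apart, for arbitrarily small
    l ([snowflake_clustered]).  A Lipschitz curve needs parameter time to jump
    from one cluster to another, during which it is outside the set.  So at
    such scales a parameter interval filled densely by visits to the set stays
    in one cluster, which makes its trace on the set short.  The intervals that
    meet the set of visits without being filled have small total length, since
    this set cannot lose a fixed proportion of its length at infinitely many
    scales.  Neither tangents nor differentiability of Lipschitz functions are
    involved ([clustered_purely_unrectifiable]). *)

(** * The Euclidean plane *)

Section Plane.
Variable R : realType.
Implicit Types (a u v w : R * R).

Definition cmul (a u : R * R) : R * R :=
  (a.1 * u.1 - a.2 * u.2, a.2 * u.1 + a.1 * u.2).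

Definition enorm u : R := Num.sqrt (u.1 ^+ 2 + u.2 ^+ 2).

Lemma edistE u v : edist u v = enorm (u - v).
Proof. by []. Qed.

Lemma edistC u v : edist u v = edist v u.
Proof. by rewrite /edist -[u.1 - _]opprB -[u.2 - _]opprB !sqrrN. Qed.

Lemma edistxx u : edist u u = 0.
Proof. by rewrite /edist !subrr expr0n /= addr0 sqrtr0. Qed.

Lemma edist_ge0 u v : 0 <= edist u v.
Proof. exact: sqrtr_ge0. Qed.

Lemma enorm_ge1 u : `|u.1| <= enorm u.
Proof. by rewrite -sqrtr_sqr ler_wsqrtr// lerDl sqr_ge0. Qed.

Lemma enorm_le u : enorm u <= `|u.1| + `|u.2|.
Proof.
have h0 : 0 <= `|u.1| + `|u.2| by rewrite addr_ge0.
rewrite -(@ler_pXn2r _ 2)// ?nnegrE ?sqrtr_ge0// sqr_sqrtr ?addr_ge0 ?sqr_ge0//.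
by rewrite sqrrD !real_normK ?num_real// lerD2r lerDl mulrn_wge0// mulr_ge0.
Qed.

Lemma enorm_cmul a u : enorm (cmul a u) = enorm a * enorm u.
Proof.
rewrite /enorm -sqrtrM ?addr_ge0 ?sqr_ge0//; congr Num.sqrt.
by rewrite /cmul /=; ring.
Qed.

Lemma cmulA a u v : cmul (cmul a u) v = cmul a (cmul u v).
Proof. by apply/pair_equal_spec; split; rewrite /=; ring. Qed.

End Plane.

(** * Hausdorff measure *)

Section Hausdorff.
Variable R : realType.
Implicit Types (A U : set (R * R)) (s d : R).

Lemma ediam_ge0 U : (0 <= ediam U)%E.
Proof. by apply: ereal_sup_ubound; left. Qed.

Lemma ediam_ub U (r : R) : 0 <= r ->
  (forall p q, U p -> U q -> edist p q <= r) -> (ediam U <= r%:E)%E.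
Proof.
move=> r0 h; apply: ge_ereal_sup => _ [->|[p Up [q Uq <-]]]; rewrite lee_fin//.
exact: h.
Qed.

Lemma edist_le_ediam U p q : U p -> U q -> ((edist p q)%:E <= ediam U)%E.
Proof. by move=> Up Uq; apply: ereal_sup_ubound; right; exists p => //;
  exists q. Qed.

Lemma ediam0 : ediam (@set0 (R * R)) = 0%E.
Proof. by apply/eqP; rewrite eq_le ediam_ge0 andbT; apply: ediam_ub. Qed.

Lemma hausdorff_gauge_ge0 s U : (0 <= hausdorff_gauge s U)%E.
Proof. by rewrite /hausdorff_gauge; case: ifP => // _; exact: poweR_ge0. Qed.

Lemma hausdorff_gauge1 U : hausdorff_gauge 1 U = ediam U.
Proof.
rewrite /hausdorff_gauge; case: eqP => [->|_]; first by rewrite ediam0.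
by rewrite poweRe1// ediam_ge0.
Qed.

Definition covers (U : nat -> set (R * R)) A d :=
  A `<=` \bigcup_i U i /\ forall i, (ediam (U i) <= d%:E)%E.

Lemma hausdorff_le s A (m : \bar R) :
  (forall d, 0 < d -> exists2 U, covers U A d &
    (\sum_(0 <= i <oo) hausdorff_gauge s (U i) <= m)%E) ->
  (hausdorff_measure s A <= m)%E.
Proof.
move=> h; apply: ge_ereal_sup => _ [d /= d0 <-].
have [U cU le] := h d d0; apply: le_trans le.
by apply: ereal_inf_lbound; exists U.
Qed.

Lemma hausdorff_ge0 s A : (0 <= hausdorff_measure s A)%E.
Proof.
apply: le_trans (_ : (hausdorff_pre s 1 A <= _)%E); last first.
  by apply: ereal_sup_ubound; exists 1 => //=.
apply: le_ereal_inf_tmp => _ [U _ <-]; apply: nneseries_ge0 => *.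
exact: hausdorff_gauge_ge0.
Qed.

Lemma hausdorff_eq0 s A :
  (forall d e, 0 < d -> 0 < e -> exists2 U, covers U A d &
    (\sum_(0 <= i <oo) hausdorff_gauge s (U i) <= e%:E)%E) ->
  hausdorff_measure s A = 0%E.
Proof.
move=> h; apply/eqP; rewrite eq_le hausdorff_ge0 andbT.
apply/lee_addgt0Pr => e e0; rewrite add0e.
by apply: hausdorff_le => d d0; exact: h.
Qed.

Lemma hausdorff_lt s A (m : \bar R) d : (hausdorff_measure s A < m)%E ->
  0 < d ->
  exists2 U, covers U A d & (\sum_(0 <= i <oo) hausdorff_gauge s (U i) < m)%E.
Proof.
move=> h d0; have : (hausdorff_pre s d A < m)%E.
  by apply: le_lt_trans h; apply: ereal_sup_ubound; exists d.
by move=> /ereal_inf_lt[_ [U cU <-] lt]; exists U.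
Qed.

(** For exponent 1 a small total diameter makes every single diameter small,
    so the mesh condition comes for free. *)
Lemma hausdorff1_eq0 A :
  (forall e, 0 < e -> exists2 U : nat -> set (R * R), A `<=` \bigcup_i U i &
    (\sum_(0 <= i <oo) ediam (U i) <= e%:E)%E) ->
  hausdorff_measure 1 A = 0%E.
Proof.
move=> h; apply: hausdorff_eq0 => d e d0 e0.
have [|U cU le] := h (Num.min d e); first by rewrite lt_min d0.
exists U; last first.
  under eq_eseriesr do rewrite hausdorff_gauge1.
  by apply: le_trans le _; rewrite lee_fin ge_min lexx orbT.
split => // i; apply: le_trans (_ : (Num.min d e)%:E <= _)%E; last first.
  by rewrite lee_fin ge_min lexx.
apply: le_trans le.
have g0 k : (0 <= k)%N -> true -> (0 <= ediam (U k))%E by move=> *;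
  exact: ediam_ge0.
apply: le_trans (nneseries_lim_ge i.+1 g0); rewrite big_nat_recr//=.
by apply: leeDr; apply: sume_ge0 => *; exact: ediam_ge0.
Qed.

Lemma hausdorff1_eq0_cover A e : hausdorff_measure 1 A = 0%E -> 0 < e ->
  exists2 U : nat -> set (R * R), A `<=` \bigcup_i U i &
    (\sum_(0 <= i <oo) ediam (U i) <= e%:E)%E.
Proof.
move=> h e0; have [||U [cU _] lt] := @hausdorff_lt 1 A e%:E 1 => //.
  by rewrite h lte_fin.
exists U => //; apply: ltW; move: lt.
by under eq_eseriesr do rewrite hausdorff_gauge1.
Qed.

(** The covers of the pieces, with errors e / 2^(i+1), are merged along a
    bijection between pairs and naturals. *)
Lemma hausdorff1_bigcup_eq0 A (E : nat -> set (R * R)) :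
  A `<=` \bigcup_i E i -> (forall i, hausdorff_measure 1 (E i) = 0%E) ->
  hausdorff_measure 1 A = 0%E.
Proof.
move=> AE E0; apply: hausdorff1_eq0 => e e0.
have /choice[U UP] : forall i, exists U : nat -> set (R * R),
    E i `<=` \bigcup_j U j /\
    (\sum_(0 <= j <oo) ediam (U j) <= (e / (2 ^ i.+1)%:R)%:E)%E.
  move=> i; have [|U cU le] := @hausdorff1_eq0_cover _ (e / (2 ^ i.+1)%:R) (E0
    i).
    by rewrite divr_gt0// ltr0n expn_gt0.
  by exists U.
have /card_esym/ppcard_eqP[f] := card_nat2.
exists (fun k => U (f k).1 (f k).2).
  move=> x /AE[i _ Eix]; have [j _ Ujx] := (UP i).1 x Eix.
  by exists (f^-1%FUN (i, j)) => //=; rewrite invK ?inE.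
rewrite nneseries_esumT; last by move=> *; exact: ediam_ge0.
have fb : set_bij [set: nat] [set: nat * nat] f by exact: bij.
rewrite -(reindex_esum _ _ f (fun p => ediam (U p.1 p.2)) fb).
apply: le_trans (epsilon_trick0 xpredT (ltW e0)).
have -> : [set: nat * nat] = [set: nat] `*`` (fun=> [set: nat]).
  by apply/seteqP; split.
rewrite -(@esum_esum _ _ _ _ _ (fun i j => ediam (U i j))); last first.
  by move=> *; exact: ediam_ge0.
rewrite -nneseries_esumT; last by move=> n; apply: esum_ge0 => *;
  exact: ediam_ge0.
apply: lee_nneseries => i *; first by apply: esum_ge0 => *; exact: ediam_ge0.
rewrite -nneseries_esumT; last by move=> *; exact: ediam_ge0.
exact: (UP i).2.
Qed.

Lemma hausdorff_set0 s : hausdorff_measure s (@set0 (R * R)) = 0%E.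
Proof.
apply: hausdorff_eq0 => d e d0 e0; exists (fun=> set0).
  by split => // i; rewrite ediam0 lee_fin ltW.
by rewrite eseries0 ?lee_fin ?ltW// => i _ _; rewrite /hausdorff_gauge eqxx.
Qed.

(** For sets of diameter at most 1 the gauge decreases with the exponent, up
    to exponent 1. *)
Lemma hausdorff_le1_eq0 s A : 0 <= s -> s <= 1 ->
  hausdorff_measure s A = 0%E -> hausdorff_measure 1 A = 0%E.
Proof.
move=> s0 s1 h; apply: hausdorff1_eq0 => e e0.
have [||U [cU dU] lt] := @hausdorff_lt s A e%:E 1 => //.
  by rewrite h lte_fin.
exists U => //; apply: le_trans (ltW lt); apply: lee_nneseries => i *.
  exact: ediam_ge0.
rewrite /hausdorff_gauge; case: eqP => [->|_]; first by rewrite ediam0.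
have := dU i; have := ediam_ge0 (U i); case: (ediam (U i)) => [r| |];
  last 2 first.
- by rewrite leye_eq.
- by rewrite leeNy_eq.
rewrite poweR_EFin !lee_fin => r0 r1.
move: r0; rewrite le_eqVlt => /predU1P[<-|r0]; first exact: powR_ge0.
by apply: ger1_powR => //; rewrite r0.
Qed.

Lemma eseries_finite (u : nat -> \bar R) N : (forall i, (0 <= u i)%E) ->
  (forall i, (N <= i)%N -> u i = 0%E) ->
  (\sum_(0 <= i <oo) u i = \sum_(0 <= i < N) u i)%E.
Proof.
move=> u0 uN; rewrite (@nneseries_split _ _ 0 N)// add0n [X in (_ +
  X)%E]eseries0 ?adde0//.
by move=> i Ni _; exact: uN.
Qed.

Lemma hausdorff_gauge_le s U (r : R) : 0 < s -> 0 <= r -> (ediam U <= r%:E)%E ->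
  (hausdorff_gauge s U <= (r `^ s)%:E)%E.
Proof.
move=> s0 r0 Ur; rewrite /hausdorff_gauge; case: eqP => _.
  by rewrite lee_fin powR_ge0.
rewrite -poweR_EFin; apply: gt0_ler_poweR => //; first exact: ltW.
  by rewrite in_itv/= ediam_ge0 leey.
by rewrite in_itv/= lee_fin r0 leey.
Qed.

Lemma hausdorff_finite_eq0 s A : 0 < s ->
  (forall d e, 0 < d -> 0 < e -> exists N (U : nat -> set (R * R)) (r : R),
    [/\ A `<=` \bigcup_(i < N) U i, forall i, (ediam (U i) <= r%:E)%E,
        0 <= r, r <= d & N%:R * r `^ s <= e]) ->
  hausdorff_measure s A = 0%E.
Proof.
move=> s0 h; apply: hausdorff_eq0 => d e d0 e0.
have [N [U [r [cU dU r0 rd le]]]] := h d e d0 e0.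
exists (fun i => if (i < N)%N then U i else set0).
  split; first by move=> x /cU[i /= iN Ux]; exists i => //; rewrite iN.
  move=> i; case: ifP => _; last by rewrite ediam0 lee_fin ltW.
  by apply: le_trans (dU i) _; rewrite lee_fin.
rewrite (@eseries_finite _ N); last 2 first.
  by move=> i; exact: hausdorff_gauge_ge0.
  by move=> i; rewrite leqNgt => /negbTE ->; rewrite /hausdorff_gauge eqxx.
apply: le_trans (_ : \sum_(0 <= i < N) (r `^ s)%:E <= _)%E.
  rewrite !big_mkord; apply: lee_sum => i _; rewrite ltn_ord.
  exact: hausdorff_gauge_le.
by rewrite sumEFin big_const_nat iter_addr addr0 subn0 -mulr_natl lee_fin.
Qed.

End Hausdorff.

(** * Sets of non-sigma-finite length *)

Section SigmaFinite.
Variable R : realType.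
Implicit Types A U : set (R * R).

Lemma fst_continuous : continuous (fun u : R * R => u.1).
Proof. by move=> u; exact: cvg_fst. Qed.

Lemma snd_continuous : continuous (fun u : R * R => u.2).
Proof. by move=> u; exact: cvg_snd. Qed.

Lemma eball_open (x : R * R) (r : R) : open (eball x r).
Proof.
rewrite (_ : eball x r = edist x @^-1` [set z | z < r]) //.
apply: open_comp; last exact: open_lt.
have sq (f : R * R -> R) : continuous f -> continuous (fun u => f u ^+ 2).
  by move=> cf u; exact: cvgM (cf u) (cf u).
move=> u _; apply: (@continuous_comp _ _ _
  (fun u : R * R => (x.1 - u.1) ^+ 2 + (x.2 - u.2) ^+ 2) Num.sqrt).
  apply: cvgD; apply: sq => v; apply: cvgB; try exact: cvg_cst.
    exact: fst_continuous.
  exact: snd_continuous.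
exact: sqrt_continuous.
Qed.

(** By compactness finitely many of the good balls cover the set. *)
Lemma weakly_locally_finite_sigma A : compact A -> weakly_locally_finite A ->
  H1_sigma_finite A.
Proof.
move=> cA wA.
have /choice[r rP] : forall y, exists r : R, A y -> 0 < r /\
    (hausdorff_measure 1 (eball y r `&` A) < +oo)%E.
  move=> y.
  have [Ay|nAy] := pselect (A y); last by exists 0.
  by have [r rP] := wA y Ay; exists r.
(* compactness by covers is stated for pointed spaces *)
have cvA : cover_compact A.
  pose T : ptopologicalType := HB.pack (R * R)%type
    (Topological.on (R * R)%type) (Pointed.on (R * R)%type).
  by suff : @cover_compact T A by []; rewrite -compact_cover.
have := cvA => /(_ _ A (fun y => eball y (r y))).
case=> [y _||D DA cD]; first exact: eball_open.
  by move=> y Ay; exists y => //; rewrite /eball /= edistxx; exact: (rP y Ay).1.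
pose s := finmap.enum_fset D.
exists (fun i => if (i < size s)%N then
  let y := nth (0, 0) s i in eball y (r y) `&` A else set0); split.
  apply/seteqP; split => [x Ax|x [i _]]; last by case: ifP => // _ [].
  have [y /= yD xy] := cD x Ax.
  have ys : y \in s by [].
  by exists (index y s) => //; rewrite index_mem ys/= nth_index.
move=> i; case: ifP => [h|_]; last by rewrite hausdorff_set0.
by have := DA _ (mem_nth (0, 0) h); rewrite inE => /rP[].
Qed.

(** Let E have finite length M. Covering E by sets of small diameter and
    pulling each of them back to an interval of the parameter line shows
    that the parameters of E have Lebesgue measure at most about eta M, for
    every eta. So the parameters of countably many such sets form a null set
    and miss part of the unit interval. *)
Lemma flat_parametrization_not_sigma_finite A (F : R -> R * R) :
  (forall y, 0 <= y < 1 -> A (F y)) ->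
  (forall eta, 0 < eta -> exists2 d, 0 < d & forall y z, 0 <= y < 1 ->
    0 <= z < 1 ->
    edist (F y) (F z) <= d -> `|y - z| <= eta * edist (F y) (F z)) ->
  ~ H1_sigma_finite A.
Proof.
move=> AF lip [E [AE finE]].
have cover i : exists I : nat ->
  set R, [/\ forall j, measurable (I j : set (measurableTypeR R)),
    forall y, 0 <= y < 1 -> E i (F y) -> (\bigcup_j I j) y &
    (\sum_(0 <= j <oo) lebesgue_measure (I j) <= ((1 / 2) / (2 ^
      i.+1)%:R)%:E)%E].
  have [M M0 hM] : exists2 M : R, 0 < M & (hausdorff_measure 1 (E i) < M%:E)%E.
    have := finE i; have := hausdorff_ge0 1 (E i).
    case: (hausdorff_measure 1 (E i)) => // r; rewrite lee_fin => r0 _.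
    by exists (r + 1); rewrite ?lte_fin; lra.
  (* the shares c of all E i add up to 1/2, less than the length of [0, 1[ *)
  pose c : R := (1 / 2) / (2 ^ i.+1)%:R.
  have c0 : 0 < c by rewrite !divr_gt0// ltr0n expn_gt0.
  have [|d d0 hd] := lip (c / (2 * M)); first by rewrite divr_gt0// mulr_gt0.
  have [U [cU dU] sU] := hausdorff_lt hM d0.
  have /choice[I IP] : forall j, exists I : set R,
      [/\ measurable (I : set (measurableTypeR R)),
       forall y, 0 <= y < 1 -> U j (F y) -> I y &
       (lebesgue_measure I <= (c / M)%:E * ediam (U j))%E].
    move=> j; have [[y0 y01 Uy0]|no] := pselect (exists2 y, 0 <= y < 1 &
      U j (F y)); last first.
      exists set0; split; [exact: measurable0| |].
        by move=> y y01 Uy; apply: no; exists y.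
      by rewrite measure0 mule_ge0 ?ediam_ge0// lee_fin divr_ge0// ltW.
    have := dU j; have := ediam_ge0 (U j); have h := @edist_le_ediam _ (U j).
    case: (ediam (U j)) h => [D| |] h; last 2 first.
    - by rewrite leye_eq.
    - by rewrite leeNy_eq.
    rewrite !lee_fin => D0 Dd.
    pose w : R := c / (2 * M) * D.
    have w0 : 0 <= w by rewrite mulr_ge0// divr_ge0// ltW// mulr_gt0.
    exists `[y0 - w, y0 + w]%classic; split; first exact: measurable_itv.
      move=> y y1 Uy; have := h _ _ Uy Uy0; rewrite lee_fin => yD.
      have := hd _ _ y1 y01 (le_trans yD Dd) => le.
      have : `|y - y0| <= w.
        by apply: le_trans le _; rewrite ler_wpM2l// divr_ge0// ltW// mulr_gt0.
      by rewrite /= in_itv /= ler_norml => /andP[? ?]; apply/andP; split; lra.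
    rewrite lebesgue_measure_itv /= -EFinM.
    case: ifP => _; last by rewrite lee_fin mulr_ge0// divr_ge0// ltW.
    rewrite -EFinD lee_fin /w le_eqVlt; apply/orP; left; apply/eqP.
    by field; rewrite gt_eqF.
  exists I; split; first by move=> j; case: (IP j).
    move=> y y1 /cU[j _ Uj]; exists j => //; have [_ h _] := IP j; exact: h.
  apply: le_trans (_ : (\sum_(0 <= j <oo) (c / M)%:E * ediam (U j) <= _)%E).
    by apply: lee_nneseries => j *; [exact: measure_ge0|case: (IP j)].
  rewrite nneseriesZl; last by move=> *; exact: ediam_ge0.
  apply: le_trans (_ : (c / M)%:E * M%:E <= _)%E.
    apply: lee_wpmul2l; first by rewrite lee_fin divr_ge0// ltW.
    by apply: ltW; move: sU; under eq_eseriesr do rewrite hausdorff_gauge1.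
  by rewrite -EFinM lee_fin divfK// gt_eqF.
have /choice[I IP] := cover.
pose V i : set (measurableTypeR R) := \bigcup_j I i j.
have mV i : measurable (V i).
  by apply: bigcup_measurable => j _; have [h _ _] := IP i.
have V2 : ((lebesgue_measure (`[0%R, 1%R[%classic : set (measurableTypeR R))
    <= \sum_(0 <= i <oo) lebesgue_measure (V i))%E).
  apply: (measure_sigma_subadditive _ mV); first exact: measurable_itv.
  move=> y; rewrite /= in_itv /= => y01; have := AF y y01;
    rewrite AE => -[i _ Ei].
  by exists i => //; have [_ h _] := IP i; exact: h.
have half : ((\sum_(0 <= i <oo) lebesgue_measure (V i)) <= (1 / 2 : R)%:E)%E.
  have h2 : (0 : R) <= 1 / 2 by lra.
  apply: le_trans (epsilon_trick0 xpredT h2).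
  apply: lee_nneseries => i *; first exact: measure_ge0.
  have [mI _ le] := IP i; apply: le_trans le.
  by apply: (measure_sigma_subadditive _ mI) => //; exact: mV.
have := le_trans V2 half; rewrite lebesgue_measure_itv /= lte_fin ltr01 sube0.
by rewrite lee_fin; lra.
Qed.

End SigmaFinite.

(** * Pure unrectifiability *)

Section Rectifiable.
Variable R : realType.
Implicit Types (A : set (R * R)) (f : R -> R * R).

(** At scale l the set falls apart into clusters of diameter at most M l: E
    is the relation of lying in the same cluster. It is only asked to be
    transitive through points of A, because E is later defined through
    addresses, which exist for points of A only. *)
Definition clustered A (M l : R) : Prop :=
  exists E : R * R -> R * R -> Prop,
  [/\ forall p q, A p -> A q -> edist p q < l -> E p q,
      forall p q r, A q -> E p q -> E q r -> E p r &
      forall p q, A p -> A q -> E p q -> edist p q <= M * l].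

Lemma sum_nat_blocks (F : nat -> nat) m p :
  (\sum_(0 <= k < m * p) F k = \sum_(0 <= i < m) \sum_(0 <= j < p) F (i * p +
    j))%N.
Proof.
elim: m => [|m IH]; first by rewrite mul0n !big_geq.
rewrite big_nat_recr//= -IH mulSn addnC (@big_cat_nat _ _ _ (m * p))
  ?leq_addr//=.
congr addn; rewrite -{1}[(m * p)%N]add0n big_addn addKn.
by apply: eq_bigr => j _; rewrite addnC.
Qed.

(** Membership of t in the dyadic interval number k of length 2^-n. *)
Definition slot n k (t : R) : Prop :=
  k%:R <= t * 2 ^+ n /\ t * 2 ^+ n < k.+1%:R.

Lemma slot_ge0 n k t : slot n k t -> 0 <= t.
Proof.
by move=> [h _]; rewrite -(pmulr_lge0 _ (exprn_gt0 n (ltr0n R 2))) (le_trans _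
  h).
Qed.

Lemma slot_exists n t : 0 <= t -> t < 1 ->
  exists2 k, (k < 2 ^ n)%N & slot n k t.
Proof.
move=> t0 t1; have p2 : 0 < 2 ^+ n :> R by rewrite exprn_gt0.
have h0 : 0 <= t * 2 ^+ n by rewrite mulr_ge0// ltW.
exists (Num.trunc (t * 2 ^+ n)); last by have /andP[] := truncn_itv h0.
by rewrite truncn_lt_nat// natrX -[ltRHS]mul1r ltr_pM2r.
Qed.

Lemma slot_refine n q i t : slot n i t ->
  exists2 j, (j < 2 ^ q)%N & slot (n + q) (i * 2 ^ q + j) t.
Proof.
move=> st; have t0 := slot_ge0 st; case: st => h1 h2.
have p2 : 0 < 2 ^+ q :> R by rewrite exprn_gt0.
have h0 : 0 <= t * 2 ^+ (n + q) by rewrite mulr_ge0// exprn_ge0.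
have /andP[a b] := truncn_itv h0; set k := Num.trunc _ in a b.
have ik : (i * 2 ^ q <= k)%N.
  rewrite -ltnS -(ltr_nat R); apply: le_lt_trans b.
  by rewrite natrM natrX exprD mulrA ler_pM2r.
have ki : (k < i.+1 * 2 ^ q)%N.
  rewrite -(ltr_nat R); apply: le_lt_trans a _.
  by rewrite natrM natrX exprD mulrA ltr_pM2r.
exists (k - i * 2 ^ q)%N; last by rewrite subnKC.
by rewrite ltn_subLR// -mulSnr.
Qed.

Lemma slot_coarsen n q i j t : (j < 2 ^ q)%N ->
  slot (n + q) (i * 2 ^ q + j) t -> slot n i t.
Proof.
move=> jq [h1 h2]; have p2 : 0 < 2 ^+ q :> R by rewrite exprn_gt0.
split.
  rewrite -(@ler_pM2r _ (2 ^+ q))// -mulrA -exprD.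
  by apply: le_trans h1; rewrite -natrX -natrM ler_nat leq_addr.
rewrite -(@ltr_pM2r _ (2 ^+ q))// -mulrA -exprD.
apply: lt_le_trans h2 _; rewrite -natrX -natrM ler_nat mulSn addnC.
by rewrite ltn_add2r.
Qed.

Lemma slot_close n k k' t t' : (k <= k')%N -> (k' <= k.+1)%N ->
  slot n k t -> slot n k' t' -> `|t - t'| <= 2 / 2 ^+ n.
Proof.
move=> kk k'k [h1 h2] [h3 h4]; have p2 : 0 < 2 ^+ n :> R by rewrite exprn_gt0.
have E : `|t - t'| * 2 ^+ n = `|t * 2 ^+ n - t' * 2 ^+ n|.
  by rewrite -mulrBl normrM (ger0_norm (ltW p2)).
have e1 : k%:R <= k'%:R :> R by rewrite ler_nat.
have e2 : k'%:R <= k.+1%:R :> R by rewrite ler_nat.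
rewrite ler_pdivlMr// E ler_norml; rewrite -natr1 in h2 e2;
  rewrite -natr1 in h4.
by apply/andP; split; lra.
Qed.

Section Curve.
Variables (A : set (R * R)) (f : R -> R * R) (K : R).
Hypotheses (K0 : 0 < K) (lipf : forall s t, edist (f s) (f t) <= K * `|s - t|).

Let hit n k : bool := `[< exists2 t, slot n k t & A (f t) >].

Let full n q i : bool := [forall j : 'I_(2 ^ q), hit (n + q) (i * 2 ^ q + j)].

Let hits n := (\sum_(0 <= i < 2 ^ n) hit n i)%N.

Let broken n q := (\sum_(0 <= i < 2 ^ n) (hit n i && ~~ full n q i))%N.

(** Passing from level n to level n + q, every interval which still meets
    the parameter set has at most 2^q descendants, and at least one of them
    is lost when the interval is not full. *)
Lemma hits_drop n q : (hits (n + q) + broken n q <= 2 ^ q * hits n)%N.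
Proof.
rewrite /hits /broken expnD sum_nat_blocks -big_split /= big_distrr /=.
apply: leq_sum => i _; have le1 : forall m,
  (\sum_(0 <= j < m) hit (n + q) (i * 2 ^ q + j) <= m)%N.
  move=> m; rewrite -[leqRHS]muln1 -[m in (m * 1)%N]subn0 -sum_nat_const_nat.
  by apply: leq_sum => j _; exact: leq_b1.
have [h|/asboolPn nh] := boolP (hit n i); last first.
  rewrite muln0 addn0 big_nat_cond big1// => j /andP[/andP[_ jq] _].
  apply/eqP; rewrite eqb0; apply/negP => /asboolP[t st At]; apply: nh.
  by exists t => //; exact: slot_coarsen st.
rewrite muln1; have [fl|] := boolP (full n q i); first by rewrite addn0.
rewrite negb_forall => /existsP[j nj]; rewrite addn1.
have jq := ltn_ord j; rewrite (@big_cat_nat _ _ _ j) ?(ltnW jq)//= (big_ltn jq)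
  (negbTE nj) add0n.
have := leq_add (le1 j) (leqnn (\sum_(j.+1 <= k < 2 ^ q) hit (n + q) (i * 2 ^ q
  + k))%N).
have : (\sum_(j.+1 <= k < 2 ^ q) hit (n + q) (i * 2 ^ q + k) <= 2 ^ q - j.+1)%N.
  rewrite -[leqRHS]muln1 -sum_nat_const_nat.
  by apply: leq_sum => k _; exact: leq_b1.
by lia.
Qed.

Let dens n : R := (hits n)%:R / 2 ^+ n.

Lemma dens_drop n q : dens (n + q) + (broken n q)%:R / 2 ^+ (n + q) <= dens n.
Proof.
rewrite /dens -mulrDl ler_pdivrMr ?exprn_gt0// exprD mulrA divfK; last first.
  by rewrite expf_neq0// pnatr_eq0.
by rewrite -natrX -natrM -natrD ler_nat mulnC hits_drop.
Qed.

(** The proportion of dyadic intervals that meet the parameter set decreases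
    to a limit, so between two late levels it hardly changes; by [hits_drop]
    few intervals are hit without being full. *)
Lemma broken_small q (eta : R) : 0 < eta ->
  exists N, forall n, (N <= n)%N -> (broken n q)%:R / 2 ^+ n <= eta.
Proof.
move=> eta0; have dens0 n : 0 <= dens n by rewrite divr_ge0// exprn_ge0.
have hl : has_inf (range dens).
  by split; [exists (dens 0%N); exists 0%N|exists 0 => _ [n _ <-]].
have p2 : 0 < 2 ^+ q :> R by rewrite exprn_gt0.
have [|_ [N _ <-] hN] := @inf_adherent _ _ (eta / 2 ^+ q) _ hl;
  first by rewrite divr_gt0.
exists N => n Nn.
have h1 : dens n <= dens N.
  rewrite -(subnKC Nn); apply: le_trans (dens_drop N (n - N)).
  by rewrite lerDl divr_ge0// exprn_ge0.
have h2 : inf (range dens) <= dens (n + q) by apply: ge_inf;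
  [exact: hl.2|exists (n + q)%N].
have h3 := dens_drop n q.
have : (broken n q)%:R / 2 ^+ (n + q) <= eta / 2 ^+ q by lra.
by rewrite exprD invfM mulrA ler_pM2r ?invr_gt0.
Qed.

(** In a full interval the curve visits the set at parameter steps so short
    that consecutive visits are less than l apart, so they all stay in one
    cluster. *)
Lemma full_cluster M l n q i : clustered A M l -> K * (2 / 2 ^+ (n + q)) < l ->
  full n q i -> forall t t', slot n i t -> slot n i t' -> A (f t) -> A (f t') ->
  edist (f t) (f t') <= M * l.
Proof.
move=> [E [E1 E2 E3]] Kl /forallP fl.
have close k k' t t' : (k <= k')%N -> (k' <= k.+1)%N -> slot (n + q) k t ->
    slot (n + q) k' t' -> A (f t) -> A (f t') -> E (f t) (f t').
  move=> kk k'k st st' At At'; apply: E1 => //; apply: le_lt_trans Kl.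
  apply: le_trans (lipf _ _) _; rewrite ler_pM2l//.
  exact: slot_close st st'.
have chain j m t t' : (j + m < 2 ^ q)%N -> slot (n + q) (i * 2 ^ q + j) t ->
    slot (n + q) (i * 2 ^ q + (j + m)) t' -> A (f t) -> A (f t') ->
      E (f t) (f t').
  elim: m t' => [|m IH] t' jm st st' At At'.
    by rewrite addn0 in st'; apply: close st st' At At'.
  have jm' : (j + m < 2 ^ q)%N by apply: leq_ltn_trans jm; rewrite leq_add2l.
  have /asboolP[u su Au] := fl (Ordinal jm').
  apply: (E2 _ (f u)) => //; first exact: IH jm' st su At Au.
  by apply: close su st' Au At'; rewrite /= ?addnS ?leqnSn.
move=> t t' st st' At At'.
have [j jq sj] := slot_refine q st; have [j' jq' sj'] := slot_refine q st'.
have [jj|jj] := leqP j j'.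
  by apply: E3 => //; apply: (chain j (j' - j)%N); rewrite ?subnKC.
by rewrite edistC; apply: E3 => //; apply: (chain j' (j - j')%N);
  rewrite ?subnKC ?(ltnW jj).
Qed.

Lemma scale_between (c : R) : 0 < c -> c < 1 ->
  exists n, 1 / 2 ^+ n < c /\ c <= 2 / 2 ^+ n.
Proof.
move=> c0 c1; have ex : exists n, 1 / 2 ^+ n < c.
  exists (Num.trunc c^-1).+1; rewrite div1r invf_plt ?posrE ?exprn_gt0//.
  apply: lt_le_trans (truncnS_gt _) _; rewrite -natrX ler_nat.
  by rewrite ltnW// ltn_expl.
case: (ex_minnP ex) => -[|n] hn hm; first by move: hn;
  rewrite expr0 divr1 ltNge (ltW c1).
exists n.+1; split => //; rewrite exprS invfM mulrA divff// leNgt.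
by apply/negP => /hm; rewrite ltnn.
Qed.

(** Cover the trace by the images of the dyadic intervals of a level n for
    which 2^-n is comparable with M l / e. Full intervals contribute at most
    M l each, so e / 2 in total, although their images could be as long as K
    2^-n; the others are few by [broken_small]. The depth q of fullness
    depends on e, K and M only, which is why the diameter of a cluster must
    be bounded by a fixed multiple of their separation. *)
Lemma curve_trace_null M : 0 < M ->
  (forall d, 0 < d -> exists l, [/\ 0 < l, l < d & clustered A M l]) ->
  hausdorff_measure 1 (A `&` f @` `[0, 1[) = 0%E.
Proof.
move=> M0 clA; apply: hausdorff1_eq0 => e e0.
pose q := (Num.trunc (8 * K * M / e)).+1.
have hq : 8 * K * M / e < 2 ^+ q.
  apply: lt_le_trans (truncnS_gt _) _; rewrite -natrX ler_nat.
  by rewrite ltnW// ltn_expl.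
have p2 n : 0 < 2 ^+ n :> R by rewrite exprn_gt0.
(* an interval that is not full costs 2 K / 2^n, so all of them cost e / 2 *)
have [|N hN] := @broken_small q (e / (4 * K));
  first by rewrite divr_gt0// mulr_gt0.
have [|l [l0 ld cl]] := clA (e / (4 * M * 2 ^+ N)).
  by rewrite divr_gt0// !mulr_gt0.
have c0 : 0 < 4 * M * l / e by rewrite divr_gt0// !mulr_gt0.
have cN : 4 * M * l / e < 1 / 2 ^+ N.
  rewrite ltr_pdivrMr// div1r [ltRHS]mulrC ltr_pdivlMr//.
  by move: ld; rewrite ltr_pdivlMr ?mulr_gt0//; lra.
have c1 : 4 * M * l / e < 1.
  apply: lt_le_trans cN _; rewrite ler_pdivrMr// mul1r.
  by rewrite exprn_ege1// (ler_nat _ 1 2).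
(* 2^n clusters of diameter M l cost at most e / 2 *)
have [n [n1 n2]] := scale_between c0 c1.
have Nn : (N <= n)%N.
  rewrite leqNgt; apply/negP => nN; have := lt_trans n1 cN; rewrite !div1r.
  rewrite ltf_pV2 ?posrE// ltNge ler_eXn2l ?(ltr_nat _ 1 2)//.
  by rewrite ltnW.
pose V i : set (R * R) := [set p | exists t, [/\ slot n i t, A (f t) &
  f t = p]].
exists (fun i => if (i < 2 ^ n)%N then V i else set0).
  move=> p [Ap [t]]; rewrite /= in_itv /= => /andP[t0 t1] ftp.
  have [k kn sk] := slot_exists n t0 t1; exists k => //; rewrite kn.
  by exists t; split => //; rewrite ftp.
rewrite (@eseries_finite _ _ (2 ^ n)); last 2 first.
  by move=> i; exact: ediam_ge0.
  by move=> i; rewrite leqNgt => /negbTE ->; exact: ediam0.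
apply: le_trans (_ : (\sum_(0 <= i < 2 ^ n)
    (M * l + K * (2 / 2 ^+ n) * (hit n i && ~~ full n q i)%:R)%:E <= _)%E).
  rewrite !big_mkord; apply: lee_sum => i _; rewrite ltn_ord.
  have Ml : 0 <= M * l by rewrite mulr_ge0// ltW.
  have K2 : 0 <= K * (2 / 2 ^+ n) by rewrite mulr_ge0 ?divr_ge0// ltW.
  apply: ediam_ub; first by rewrite addr_ge0// mulr_ge0.
  move=> _ _ [t [st At <-]] [t' [st' At' <-]].
  have -> : hit n i by apply/asboolP; exists t.
  have [fl|nf] /= := boolP (full n q i).
    rewrite mulr0 addr0; apply: full_cluster cl _ fl _ _ st st' At At'.
    have h1 : K * (2 / 2 ^+ (n + q)) <= K * (2 * (4 * M * l / e) / 2 ^+ q).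
      have -> : 2 / 2 ^+ (n + q) = 2 * (1 / 2 ^+ n) / 2 ^+ q :> R.
        by rewrite exprD; field; rewrite !gt_eqF.
      by rewrite ler_pM2l// ler_pM2r ?invr_gt0// ler_pM2l// ltW.
    apply: le_lt_trans h1 _; rewrite -(@ltr_pM2r _ (2 ^+ q))//.
    have -> : K * (2 * (4 * M * l / e) / 2 ^+ q) * 2 ^+ q = 8 * K * M / e * l.
      by field; rewrite !gt_eqF.
    by rewrite [ltRHS]mulrC ltr_pM2r.
  rewrite mulr1; apply: le_trans (lipf _ _) _.
  apply: le_trans (_ : K * (2 / 2 ^+ n) <= _); last by rewrite lerDr.
  by rewrite ler_pM2l//; exact: slot_close st st'.
rewrite sumEFin lee_fin big_split /= sumr_const_nat subn0 -mulr_sumr.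
have -> : \sum_(0 <= i < 2 ^ n) (hit n i && ~~ full n q i)%:R = (broken n q)%:R
  :> R.
  by rewrite /broken natr_sum.
have h1 : M * l *+ 2 ^ n <= e / 2.
  rewrite -mulr_natr natrX; move: n2;
    rewrite ler_pdivlMr// => /(ler_wpM2r (ltW e0)).
  have -> : 4 * M * l / e * 2 ^+ n * e = 4 * (M * l * 2 ^+ n) by field;
    rewrite gt_eqF.
  by lra.
have h2 : K * (2 / 2 ^+ n) * (broken n q)%:R <= e / 2.
  have := hN n Nn; rewrite -(@ler_pM2l _ (2 * K)) ?mulr_gt0//.
  have -> : 2 * K * (e / (4 * K)) = e / 2 by field; rewrite gt_eqF.
  by apply: le_trans; rewrite le_eqVlt; apply/orP; left; apply/eqP; ring.
by lra.
Qed.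

End Curve.

Lemma elipschitz_pos f : elipschitz f ->
  exists2 K : R, 0 < K & forall s t, edist (f s) (f t) <= K * `|s - t|.
Proof.
move=> [k hk]; exists (`|k| + 1) => [|s t]; first by rewrite ltr_wpDl.
apply: le_trans (hk s t) _; rewrite ler_wpM2r// (le_trans (ler_norm k))//.
by rewrite lerDl.
Qed.

(** A Lipschitz image of the line is a countable union of images of unit
    intervals, and on each of them [curve_trace_null] applies. *)
Lemma clustered_purely_unrectifiable A M : 0 < M ->
  (forall d, 0 < d -> exists l, [/\ 0 < l, l < d & clustered A M l]) ->
  purely_unrectifiable1 A.
Proof.
move=> M0 clA F FA [M1 [f [M1_0 lipf FM]]].
pose g i z (t : R) := f i (t + (z : int)%:~R).
have g0 i z : hausdorff_measure 1 (A `&` g i z @` `[0, 1[) = 0%E.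
  have [K K0 hK] := elipschitz_pos (lipf i).
  apply: (curve_trace_null K0 _ M0 clA) => s t; apply: le_trans (hK _ _) _.
  by rewrite opprD addrACA subrr addr0.
have h i : hausdorff_measure 1 (A `&` range (f i)) = 0%E.
  pose zs (n : nat) : int := odflt 0 (unpickle n).
  apply: (@hausdorff1_bigcup_eq0 _ _ (fun n => A `&` g i (zs n) @` `[0,
    1[)) => //.
  move=> p [Ap [t _ ftp]].
  exists (pickle (Num.floor t)) => //; split => //.
  exists (t - (Num.floor t)%:~R); last by rewrite /g /zs pickleK /= subrK.
  rewrite /= in_itv /= subr_ge0 floor_le_tmp ltrBlDr addrC.
  by have := floorD1_gt t; rewrite intrD1.
apply: (@hausdorff1_bigcup_eq0 _ _ (fun n =>
  if n is i.+1 then A `&` range (f i) else M1)).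
  move=> p Fp; case: (FM p Fp) => [Mp|[i _ fp]]; first by exists 0%N.
  by exists i.+1 => //; split => //; exact: FA.
by case.
Qed.

End Rectifiable.

(** * Parameters of the construction *)

(** [slope k] is t_k, [keep k] is the shrinking factor s_k, and [growth k]
    is the total length P_k. The sequence P_k is not monotone, as it drops
    at every shrinking, whence the nondecreasing lower bound [growth_lb].
    The slopes do not increase, so that the diamonds of children fit into
    the diamond of their parent. The bound 1/64 on the slopes is a
    convenient value for the inequalities of the Koch cell. *)
Record schedule (R : realType) := Schedule {
  slope : nat -> R;
  keep : nat -> R;
  growth : nat -> R;
  growth_lb : nat -> R;
  slope_gt0 : forall k, 0 < slope k;
  slope_le : forall k, slope k <= 1 / 64;
  slope_noninc : forall k, slope k.+1 <= slope k;
  slope_small : forall e : R, 0 < e -> exists K, forall k, (K <= k)%N ->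
    slope k < e;
  keep_cases : forall k, keep k = 1 \/ keep k = 1 / 2;
  keep_half : forall K, exists k, (K <= k)%N /\ keep k = 1 / 2;
  growth0 : growth 0 = 1;
  growthS : forall k, growth k.+1 = growth k * ((1 + slope k ^+ 2) * keep k);
  growth_le : forall k, growth k <= k.+1%:R;
  growth_lb_gt0 : forall k, 0 < growth_lb k;
  growth_lb_le : forall k, growth_lb k <= growth k;
  growth_lb_nondec : forall k, growth_lb k <= growth_lb k.+1;
  growth_lb_unbounded : forall M : R, exists k, M <= growth_lb k
}.

Lemma trunc_log4S n : (0 < n)%N ->
  trunc_log 4 n.+1 = trunc_log 4 n \/ trunc_log 4 n.+1 = (trunc_log 4 n).+1.
Proof.
move=> n0; have h1 := leq_trunc_log 4 (leqnSn n).
have h2 : (trunc_log 4 n.+1 <= (trunc_log 4 n).+1)%N.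
  by rewrite -trunc_logMp//; apply: leq_trunc_log; lia.
by lia.
Qed.

Lemma trunc_log4_ge n k : (4 ^ n <= k)%N -> (n <= trunc_log 4 k)%N.
Proof. exact: trunc_log_max. Qed.

(** With n = k + 4^6 and L = floor (log_4 n), take t_k^2 = 1/n, so that the
    factors 1 + t_k^2 = (n + 1) / n telescope, and shrink by 1/2 exactly
    when L jumps. Between two jumps the length is multiplied by about 4, of
    which a jump takes back a factor 2: the length is proportional to n /
    2^L, which lies between 2^L and 2^(L+2). The shift 4^6 makes the slopes
    at most 1/64. *)
Lemma schedule_exists (R : realType) : schedule R.
Proof.
have [m m64 m0] : {m : nat | m = (4 ^ 6)%N & (0 < m)%N} by exists (4 ^ 6)%N;
  rewrite ?expn_gt0.
pose L k := trunc_log 4 (k + m).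
have LS k : L k.+1 = L k \/ L k.+1 = (L k).+1.
  by rewrite /L addSn; apply: trunc_log4S; rewrite addn_gt0 m0 orbT.
have L6 k : (6 <= L k)%N by apply: trunc_log4_ge; rewrite -m64 leq_addl.
have L0 : L 0 = 6%N by rewrite /L add0n m64 trunc_expnK.
have Lunb K : exists k, (K <= L k)%N.
  by exists (4 ^ K)%N; apply: trunc_log4_ge; apply: leq_addr.
have Llow k : (4 ^ L k <= k + m)%N by apply: trunc_logP;
  rewrite ?addn_gt0 ?m0 ?orbT.
have n0 k : 0 < (k + m)%:R :> R by rewrite ltr0n addn_gt0 m0 orbT.
have mR : m%:R = 64 ^+ 2 :> R by rewrite m64 -[64]/((4 ^ 3)%:R) -natrX -expnM.
have p2 k : 0 < 2 ^+ k :> R by apply: exprn_gt0.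
pose t k : R := Num.sqrt (1 / (k + m)%:R).
have tt k : t k ^+ 2 = 1 / (k + m)%:R by rewrite sqr_sqrtr// divr_ge0// ltW.
pose s k : R := 2 ^+ L k / 2 ^+ L k.+1.
pose P k : R := (k + m)%:R / m%:R * (2 ^+ 6 / 2 ^+ L k).
pose B k : R := 2 ^+ L k / 2 ^+ 6.
have sE k : s k = 1 \/ s k = 1 / 2.
  rewrite /s; case: (LS k) => ->; [left|right]; first by rewrite divff// gt_eqF.
  by rewrite exprS; field; rewrite gt_eqF.
apply: (@Schedule R t s P B).
- by move=> k; rewrite sqrtr_gt0 divr_gt0.
- move=> k; have h64 : (0 : R) <= 1 / 64 by lra.
  rewrite -(@ler_pXn2r _ 2)// ?nnegrE ?sqrtr_ge0// tt expr_div_n expr1n -mR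
    ler_pM2l// lef_pV2 ?posrE//; last by rewrite ltr0n.
  by rewrite ler_nat leq_addl.
- move=> k; rewrite ler_wsqrtr// ler_pM2l// lef_pV2 ?posrE//.
  by rewrite ler_nat addSn.
- move=> e e0; have [K hK] : exists K : nat, (e ^+ 2)^-1 < K%:R.
    by exists (Num.trunc (e ^+ 2)^-1).+1; apply: truncnS_gt.
  exists K => k kK; rewrite -(@ltr_pXn2r _ 2)// ?nnegrE ?sqrtr_ge0//;
    last exact: ltW.
  rewrite tt ltr_pdivrMr// -ltr_pdivrMl ?exprn_gt0// mulr1.
  by apply: lt_le_trans hK _; rewrite ler_nat (leq_trans kK)// leq_addr.
- exact: sE.
- move=> K; case: (pselect (exists k, (K <= k)%N /\ s k = 1 / 2)) => // nex.
  have cst k : (K <= k)%N -> L k = L K.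
    elim: k => [|k IH]; first by rewrite leqn0 => /eqP ->.
    rewrite leq_eqVlt => /predU1P[<-//|Kk]; rewrite -(IH Kk).
    case: (LS k) => // e; exfalso; apply: nex; exists k; split => //.
    by rewrite /s e exprS; field; rewrite gt_eqF.
  have [k hk] := Lunb (L K).+1.
  have : (L k <= L (maxn K k))%N.
    by apply: leq_trunc_log; rewrite leq_add2r leq_maxr.
  by rewrite (cst (maxn K k)) ?leq_maxl// leqNgt hk.
- have mn0 : m%:R != 0 :> R by rewrite pnatr_eq0 -lt0n.
  by rewrite /P L0 add0n !divff ?mulr1// expf_neq0 ?pnatr_eq0.
- move=> k; rewrite /P /s tt.
  have -> : (k.+1 + m)%:R = 1 + (k + m)%:R :> R by rewrite addSn -addn1 addnC
    natrD.
  have mn0 : m%:R != 0 :> R by rewrite pnatr_eq0 -lt0n.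
  by field; rewrite -natrD mn0 !gt_eqF.
- move=> k; rewrite /P.
  have h1 : (k + m)%:R / m%:R <= k.+1%:R :> R.
    rewrite ler_pdivrMr ?ltr0n// -natrM ler_nat mulSn addnC leq_add2l.
    by rewrite leq_pmulr.
  have h2 : 2 ^+ 6 / 2 ^+ L k <= 1 :> R.
    by rewrite ler_pdivrMr// mul1r ler_eXn2l// (ltr_nat _ 1 2).
  rewrite -[X in _ <= X]mulr1; apply: ler_pM => //; apply: divr_ge0 => //;
    exact: ltW.
- by move=> k; rewrite divr_gt0.
- move=> k; rewrite /B /P.
  have h : 2 ^+ L k * 2 ^+ L k <= (k + m)%:R :> R.
    by rewrite -exprMn -natrM -natrX ler_nat.
  rewrite mR (_ : (64 : R) = 2 ^+ 6); last by rewrite -natrX.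
  have h' : 2 ^+ L k <= (k + m)%:R / 2 ^+ L k :> R by rewrite ler_pdivlMr.
  have -> : (k + m)%:R / (2 ^+ 6) ^+ 2 * (2 ^+ 6 / 2 ^+ L k) =
    ((k + m)%:R / 2 ^+ L k) / 2 ^+ 6 :> R by field; rewrite !gt_eqF.
  by rewrite ler_pM2r ?invr_gt0.
- move=> k; rewrite ler_pM2r ?invr_gt0// ler_eXn2l ?(ltr_nat _ 1 2)//.
  by apply: leq_trunc_log; rewrite leq_add2r.
- move=> M; have [K hK] : exists K : nat, M * 2 ^+ 6 < K%:R.
    by exists (Num.trunc (M * 2 ^+ 6)).+1; apply: truncnS_gt.
  have [k hk] := Lunb K; exists k;
    rewrite /B ler_pdivlMr// (le_trans (ltW hK))//.
  apply: le_trans (_ : 2 ^+ K <= _);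
    last by rewrite ler_eXn2l// (ltr_nat _ 1 2).
  by rewrite -natrX ler_nat ltnW// ltn_expl.
Qed.

(** * One Koch cell *)

Section KochCell.
Variable R : realType.
Implicit Types (t s : R) (u v w : R * R) (i j : nat).

(** As complex numbers the four edges of the generator are (1 + t^2) / 4, (1
    + i t)^2 / 4, (1 - i t)^2 / 4 and (1 + t^2) / 4: their sum is 1 and they
    have the same modulus. As the outer edges are aligned with the base, the
    turning at the end of a piece does not add up over the levels. *)
Definition vertex t j : R * R :=
  match j with
  | 0 => (0, 0)
  | 1 => ((1 + t ^+ 2) / 4, 0)
  | 2 => (1 / 2, t / 2)
  | 3 => (1 - (1 + t ^+ 2) / 4, 0)
  | _ => (1, 0)
  end.

Definition edge t j : R * R := vertex t j.+1 - vertex t j.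

Definition shrink s u : R * R := ((1 - s) / 2 + s * u.1, s * u.2).

Definition step t s j u : R * R := vertex t j + cmul (edge t j) (shrink s u).

(** The relation of lying to the right within slope c; for a fixed c it is
    transitive, and [diamond c] is the order interval between the two ends
    of the unit segment. *)
Definition cone (c : R) u v : Prop := `|v.2 - u.2| <= c * (v.1 - u.1).

Definition diamond (c : R) : set (R * R) :=
  [set u | cone c (0, 0) u /\ cone c u (1, 0)].

Lemma edge_sqr t j : (j < 4)%N ->
  (edge t j).1 ^+ 2 + (edge t j).2 ^+ 2 = ((1 + t ^+ 2) / 4) ^+ 2.
Proof. by case: j => [|[|[|[|//]]]] _ /=; field. Qed.

Lemma cone_trans c u v w : cone c u v -> cone c v w -> cone c u w.
Proof.
rewrite /cone => uv vw.
have -> : w.2 - u.2 = (w.2 - v.2) + (v.2 - u.2) by ring.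
have := ler_normD (w.2 - v.2) (v.2 - u.2); lra.
Qed.

Lemma diamondP c u : diamond c u <->
  [/\ - (c * u.1) <= u.2, u.2 <= c * u.1,
      - (c * (1 - u.1)) <= u.2 & u.2 <= c * (1 - u.1)].
Proof.
rewrite /diamond /cone /= !subr0 sub0r normrN !ler_norml.
by split=> [[/andP[? ?] /andP[? ?]]|[? ? ? ?]]; split=> //; apply/andP.
Qed.

Lemma diamond_mono c c' : 0 < c' -> c' <= c -> diamond c' `<=` diamond c.
Proof.
move=> c'0 cc' u /diamondP[h1 h2 h3 h4]; apply/diamondP.
have u0 : 0 <= u.1 by rewrite -(pmulr_rge0 _ c'0); lra.
have u1 : 0 <= 1 - u.1 by rewrite -(pmulr_rge0 _ c'0); lra.
have k1 := ler_wpM2r u0 cc'; have k2 := ler_wpM2r u1 cc'.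
by split; lra.
Qed.

Lemma diamond_re c u : 0 < c -> diamond c u -> 0 <= u.1 /\ u.1 <= 1.
Proof.
move=> c0 /diamondP[h1 h2 h3 h4].
have u0 : 0 <= u.1 by rewrite -(pmulr_rge0 _ c0); lra.
have u1 : 0 <= 1 - u.1 by rewrite -(pmulr_rge0 _ c0); lra.
by split; lra.
Qed.

Lemma diamond_shrink c s u : 0 <= c -> 0 <= s -> s <= 1 -> diamond c u ->
  diamond c (shrink s u).
Proof.
move=> c0 s0 s1 /diamondP[h1 h2 h3 h4]; apply/diamondP; rewrite /shrink /=.
have c1 : 0 <= c * (1 - s) by apply: mulr_ge0 => //; lra.
have k1 := ler_wpM2l s0 h1; have k2 := ler_wpM2l s0 h2.
have k3 := ler_wpM2l s0 h3; have k4 := ler_wpM2l s0 h4.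
by split; lra.
Qed.

(** The height t / 2 of the generator plus the thickness of a diamond fits
    under the slope 16 t, because the tilted edges stay away from both ends. *)
Lemma diamond_vertex_edge t j w : 0 < t -> t <= 1 / 64 -> (j < 4)%N ->
  diamond (16 * t) w -> diamond (16 * t) (vertex t j + cmul (edge t j) w).
Proof.
move=> t0 t1 j4 dw; have t16 : 0 < 16 * t by lra.
have [w0 w1] := diamond_re t16 dw; move/diamondP: dw => [h1 h2 h3 h4].
have tt : t ^+ 2 <= t / 64 by nra.
have tt0 : 0 <= t ^+ 2 by nra.
have tw0 : 0 <= t * w.1 by nra.
have tw1 : t * w.1 <= t by nra.
have m1 : t * w.2 <= t * (8 * t) by nra.
have m2 : - (t * (8 * t)) <= t * w.2 by nra.
have m3 : t ^+ 2 * w.2 <= t / 64 by nra.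
have m4 : - (t / 64) <= t ^+ 2 * w.2 by nra.
have ttw0 : 0 <= t ^+ 2 * w.1 by nra.
have ttw1 : t ^+ 2 * w.1 <= t ^+ 2 by nra.
have t3 : t * t ^+ 2 <= t / 64 / 64 by nra.
have t30 : 0 <= t * t ^+ 2 by nra.
have n1 : t * (t * w.2) <= t / 64 / 8 by nra.
have n2 : - (t / 64 / 8) <= t * (t * w.2) by nra.
have n3 : 0 <= t * (t ^+ 2 * w.1) by nra.
have n4 : t * (t ^+ 2 * w.1) <= t * t ^+ 2 by nra.
apply/diamondP; case: j j4 => [|[|[|[|//]]]] _ /=; split; nra.
Qed.

(** A tilted edge makes an angle of about 2 t with the axis, which added to
    the aperture 16 t of the diamond remains below 32 t. *)
Lemma edge_cone t j w : 0 < t -> t <= 1 / 64 -> (j < 4)%N ->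
  0 <= w.1 -> `|w.2| <= 16 * t * w.1 ->
  `|(cmul (edge t j) w).2| <= 32 * t * (cmul (edge t j) w).1 /\
  (1 + t ^+ 2) / 8 * w.1 <= (cmul (edge t j) w).1.
Proof.
move=> t0 t1 j4 w0; rewrite ler_norml => /andP[h1 h2].
have tt : t ^+ 2 <= t / 64 by nra.
have tt0 : 0 <= t ^+ 2 by nra.
have tw0 : 0 <= t * w.1 by nra.
have ttw1 : t ^+ 2 * w.1 <= w.1 / 64 / 64 by nra.
have ttw0 : 0 <= t ^+ 2 * w.1 by nra.
have m1 : t * w.2 <= 16 * (t ^+ 2 * w.1) by nra.
have m2 : - (16 * (t ^+ 2 * w.1)) <= t * w.2 by nra.
have n1 : t ^+ 2 * w.2 <= 16 * (t / 64 / 64 * w.1) by nra.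
have n2 : - (16 * (t / 64 / 64 * w.1)) <= t ^+ 2 * w.2 by nra.
have n4 : t * (t ^+ 2 * w.1) <= t * (w.1 / 64 / 64) by nra.
have n3 : 0 <= t * (t ^+ 2 * w.1) by nra.
have q1 : t * (t * w.2) <= 16 * (t * (t ^+ 2 * w.1)) by nra.
have q2 : - (16 * (t * (t ^+ 2 * w.1))) <= t * (t * w.2) by nra.
rewrite ler_norml.
by case: j j4 => [|[|[|[|//]]]] _ /=; split; try (apply/andP; split); nra.
Qed.

Lemma vertex_cone t i j : 0 < t -> t <= 1 / 64 -> (i <= j)%N -> (j <= 4)%N ->
  cone (32 * t) (vertex t i) (vertex t j) /\
  (j%:R - i%:R) / 8 <= (vertex t j).1 - (vertex t i).1.
Proof.
move=> t0 t1; elim: j => [|j IH] ij j4.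
  by move: ij; rewrite leqn0 => /eqP ->;
    rewrite /cone !subrr normr0 mulr0 mul0r.
move: ij; rewrite leq_eqVlt => /predU1P[->|ij].
  by rewrite /cone !subrr normr0 mulr0 mul0r.
have [c1 r1] := IH ij (ltnW j4).
have w1 : (0 : R) <= (1, 0 : R).1 by rewrite /= ler01.
have w2 : `|(1 : R, 0 : R).2| <= 16 * t * (1 : R, 0 : R).1.
  by rewrite /= normr0; lra.
have [] := edge_cone t0 t1 j4 w1 w2.
rewrite /cmul /= !mulr1 !mulr0 subr0 addr0 => c2 r2.
split; first exact: cone_trans c1 c2.
have tt0 : 0 <= t ^+ 2 by apply: sqr_ge0.
have E : j.+1%:R = j%:R + 1 :> R by rewrite -addn1 natrD.
by rewrite E; lra.
Qed.

Lemma step_cone t s i u : 0 < t -> t <= 1 / 64 -> 0 <= s -> s <= 1 ->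
  (i < 4)%N -> diamond (16 * t) u ->
  [/\ cone (32 * t) (vertex t i) (step t s i u),
      cone (32 * t) (step t s i u) (vertex t i.+1),
      (1 + t ^+ 2) / 8 * (shrink s u).1 <= (step t s i u).1 - (vertex t i).1 &
      (1 + t ^+ 2) / 8 * (1 - (shrink s u).1) <=
        (vertex t i.+1).1 - (step t s i u).1].
Proof.
move=> t0 t1 s0 s1 i4 du; have t16 : 0 < 16 * t by lra.
have dw := diamond_shrink (ltW t16) s0 s1 du; rewrite /step.
have [w0 w1] := diamond_re t16 dw.
move: (shrink s u) dw w0 w1 => w [c1 c2] w0 w1.
have [||a1 a2] := @edge_cone t i w t0 t1 i4 => //.
  by move: c1; rewrite /cone /= !subr0.
have [||b1 b2] := @edge_cone t i (1 - w.1, - w.2) t0 t1 i4.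
  by rewrite /=; lra.
  by move: c2; rewrite /cone /= sub0r.
have E (f : R * R -> R) : vertex t i.+1 = vertex t i + edge t i.
  by rewrite /edge addrC subrK.
split.
- by rewrite /cone /= addrC addKr [(vertex t i).1 + _]addrC addrK.
- rewrite /cone (E fst) /=; move: b1 => /=.
  set x := (edge t i); set v := vertex t i.
  have -> : x.2 * (1 - w.1) + x.1 * - w.2 =
    v.2 + x.2 - (v.2 + (x.2 * w.1 + x.1 * w.2)) by ring.
  have -> // : x.1 * (1 - w.1) - x.2 * - w.2 =
    v.1 + x.1 - (v.1 + (x.1 * w.1 - x.2 * w.2)) by ring.
- by apply: le_trans a2 _; rewrite /= [(vertex t i).1 + _]addrC addrK.
- apply: le_trans b2 _; rewrite (E fst) /=.
  by set x := (edge t i); set v := vertex t i; lra.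
Qed.

(** Two points in different children are separated by vertices of the
    generator, and the cone relations along the way compose. The lower bound
    keeps track of the distances to the ends of the children, which matter
    for neighbours. *)
Lemma step_lt t s i j u v : 0 < t -> t <= 1 / 64 -> 0 <= s -> s <= 1 ->
  (i < j)%N -> (j < 4)%N -> diamond (16 * t) u -> diamond (16 * t) v ->
  cone (32 * t) (step t s i u) (step t s j v) /\
  (j%:R - i%:R - 1) / 8 +
    (1 + t ^+ 2) / 8 * (1 - (shrink s u).1 + (shrink s v).1) <=
  (step t s j v).1 - (step t s i u).1.
Proof.
move=> t0 t1 s0 s1 ij j4 du dv.
have [_ a2 _ a4] := step_cone t0 t1 s0 s1 (ltn_trans ij j4) du.
have [b1 _ b3 _] := step_cone t0 t1 s0 s1 j4 dv.
have [c1 c2] := vertex_cone t0 t1 ij (ltnW j4).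
split; first exact: cone_trans (cone_trans a2 c1) b1.
have E : i.+1%:R = i%:R + 1 :> R by rewrite -addn1 natrD.
by rewrite E in c2; lra.
Qed.

End KochCell.

Arguments step : simpl never.

(** * Points as traces of nested cells *)

Section Trace.
Variables (R : realType) (S : schedule R).
Implicit Types (d e : nat -> nat) (x y : nat -> R * R) (k n : nat).

Definition len k : R := growth S k / 4 ^+ k.

Definition cell k : set (R * R) := diamond (16 * slope S k).

Definition child k j u := step (slope S k) (keep S k) j u.

(** A point of the limit set with its address d: x n is the position of the
    point in the frame of the level n piece that contains it. *)
Definition trace d x : Prop :=
  forall n, [/\ (d n < 4)%N, cell n (x n) & x n = child n (d n) (x n.+1)].

Definition snowflake : set (R * R) :=
  [set z | exists d x, trace d x /\ x 0%N = z].

Definition agree d e n : Prop := forall i, (i < n)%N -> d i = e i.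

(** The complex factor of the similarity that maps the frame of the piece
    with digits d 0, ..., d (n-1) to the plane. *)
Fixpoint turn d n : R * R :=
  if n is n'.+1 then
    cmul (turn d n') (cmul (edge (slope S n') (d n')) (keep S n', 0))
  else (1, 0).

Lemma keep01 k : 0 < keep S k /\ keep S k <= 1.
Proof. by case: (keep_cases S k) => ->; split; lra. Qed.

Lemma growth_gt0 k : 0 < growth S k.
Proof. exact: lt_le_trans (growth_lb_gt0 S k) (growth_lb_le S k). Qed.

Lemma len_gt0 k : 0 < len k.
Proof. by rewrite divr_gt0 ?growth_gt0// exprn_gt0. Qed.

Lemma lenS k : len k.+1 = len k * ((1 + slope S k ^+ 2) / 4 * keep S k).
Proof.
have h : 4 ^+ k != 0 :> R by rewrite expf_neq0// pnatr_eq0.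
rewrite /len growthS (exprS 4); move: (slope S k) (4 ^+ k) h => t p h.
by field; rewrite h.
Qed.

Lemma slope_bounds k :
  [/\ 0 < slope S k, slope S k <= 1 / 64, 0 <= slope S k ^+ 2 &
      slope S k ^+ 2 <= 1 / 64].
Proof.
have h0 := slope_gt0 S k; have h1 := slope_le S k.
by split => //; [exact: sqr_ge0|nra].
Qed.

Lemma len_half k : len k.+1 <= len k / 2.
Proof.
rewrite lenS ler_pM2l ?len_gt0//.
have [_ _ h1 h2] := slope_bounds k; have [h3 h4] := keep01 k; nra.
Qed.

Lemma len_noninc k n : (k <= n)%N -> len n <= len k.
Proof.
elim: n => [|n IH]; first by rewrite leqn0 => /eqP ->.
rewrite leq_eqVlt => /predU1P[->//|/IH h]; apply: le_trans h.
by have := len_half n; have := len_gt0 n; lra.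
Qed.

Lemma len_small (e : R) : 0 < e -> exists N, forall k, (N <= k)%N -> len k < e.
Proof.
move=> e0; pose N := (Num.trunc e^-1).+1; exists N => k Nk.
apply: le_lt_trans (len_noninc Nk) _.
have h n : len n <= 1 / 2 ^+ n.
  elim: n => [|n IH]; first by rewrite /len growth0 expr0.
  apply: le_trans (len_half n) _; rewrite exprS.
  have -> : 1 / (2 * 2 ^+ n) = 1 / 2 ^+ n / 2 :> R.
    by field; rewrite expf_neq0// pnatr_eq0.
  by rewrite ler_pM2r// invr_gt0.
apply: le_lt_trans (h N) _; rewrite div1r invf_plt ?posrE ?exprn_gt0//.
apply: lt_le_trans (truncnS_gt _) _; rewrite -natrX ler_nat.
by rewrite ltnW// ltn_expl.
Qed.

Lemma cell_box k u : cell k u -> [/\ 0 <= u.1, u.1 <= 1 & `|u.2| <= 1 / 2].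
Proof.
have [h1 h2 _ _] := slope_bounds k; have h3 : 0 < 16 * slope S k by lra.
move=> du; have [u0 u1] := diamond_re h3 du; move/diamondP: du => [a1 a2 a3 a4].
by split => //; rewrite ler_norml; apply/andP; split; nra.
Qed.

Lemma cell_dist k u v : cell k u -> cell k v -> edist u v <= 2.
Proof.
move=> /cell_box[u0 u1 u2] /cell_box[v0 v1 v2].
rewrite edistE; apply: le_trans (enorm_le _) _ => /=.
have h1 : `|u.1 - v.1| <= 1 by rewrite ler_norml; apply/andP; split; lra.
by have h2 := ler_normB u.2 v.2; lra.
Qed.

Lemma child_cell k j u : (j < 4)%N -> cell k.+1 u -> cell k (child k j u).
Proof.
move=> j4 du; have [h1 h2 _ _] := slope_bounds k; have [h3 h4] := keep01 k.
have [h5 _ _ _] := slope_bounds k.+1; have h6 := slope_noninc S k.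
apply: diamond_vertex_edge => //; apply: diamond_shrink => //; try lra.
by apply: diamond_mono du; lra.
Qed.

Lemma enorm_turn d n : (forall i, (d i < 4)%N) -> enorm (turn d n) = len n.
Proof.
move=> d4; elim: n => [|n IH].
  by rewrite /= /enorm /= expr1n expr0n /= addr0 sqrtr1 /len growth0 expr0
    divr1.
rewrite /= enorm_cmul IH lenS; congr (_ * _).
have [h3 h4] := keep01 n; have [_ _ h1 h2] := slope_bounds n.
rewrite enorm_cmul {1}/enorm edge_sqr// sqrtr_sqr ger0_norm; last lra.
by rewrite /enorm /= expr0n /= addr0 sqrtr_sqr gtr0_norm.
Qed.

Lemma turnP d e x y n : trace d x -> trace e y -> agree d e n ->
  x 0%N - y 0%N = cmul (turn d n) (x n - y n).
Proof.
move=> tx ty; elim: n => [|n IH] ag.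
  by apply/pair_equal_spec; split; rewrite /=; ring.
have {IH} -> := IH (fun i h => ag i (ltnW h)).
have [_ _ ->] := tx n; have [_ _ ->] := ty n;
  rewrite -(ag n)// /turn -/turn cmulA.
congr cmul; rewrite /child /step /shrink; move: (edge _ _) (vertex _ _) => a v.
by apply/pair_equal_spec; split; rewrite /=; ring.
Qed.

Lemma agree_edist d e x y n : trace d x -> trace e y -> agree d e n ->
  edist (x 0%N) (y 0%N) = len n * edist (x n) (y n).
Proof.
move=> tx ty ag; rewrite !edistE (turnP tx ty ag) enorm_cmul enorm_turn//.
by move=> i; case: (tx i).
Qed.

Lemma agree_edist_le d e x y n : trace d x -> trace e y -> agree d e n ->
  edist (x 0%N) (y 0%N) <= 2 * len n.
Proof.
move=> tx ty ag; rewrite (agree_edist tx ty ag) mulrC ler_pM2r ?len_gt0//.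
by apply: (@cell_dist n); [case: (tx n)|case: (ty n)].
Qed.

Lemma first_difference d e n : d n <> e n ->
  exists m, [/\ (m <= n)%N, agree d e m & d m <> e m].
Proof.
move=> dn; have ex : exists m, d m != e m by exists n; apply/eqP.
case: (ex_minnP ex) => m /eqP dm mmin; exists m; split => //.
  by apply: mmin; apply/eqP.
move=> i im; apply/eqP; apply: contraTT im => /mmin.
by rewrite -leqNgt.
Qed.

Lemma trace_lt d e x y n : trace d x -> trace e y -> (d n < e n)%N ->
  cone (32 * slope S n) (x n) (y n) /\
  ((e n)%:R - (d n)%:R - 1) / 8 + (1 + slope S n ^+ 2) / 8 * keep S n *
    (1 - (x n.+1).1 + (y n.+1).1) <= (y n).1 - (x n).1.
Proof.
move=> tx ty de; have [dn cx ->] := tx n; have [en cy ->] := ty n.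
have [h1 h2 h3 h4] := slope_bounds n; have [h5 h6] := keep01 n.
have m u : cell n.+1 u -> diamond (16 * slope S n) u.
  have [h7 _ _ _] := slope_bounds n.+1; have := slope_noninc S n => h8.
  by apply: diamond_mono; lra.
have cx1 : cell n.+1 (x n.+1) by case: (tx n.+1).
have cy1 : cell n.+1 (y n.+1) by case: (ty n.+1).
have [c r] := @step_lt _ _ (keep S n) _ _ _ _ h1 h2 (ltW h5) h6 de en (m _ cx1)
  (m _ cy1).
split => //; apply: le_trans r; rewrite lerD2l -mulrA ler_pM2l; last lra.
by rewrite /shrink /=; lra.
Qed.

Lemma trace_first d x n : trace d x -> d n = 0%N ->
  (1 + slope S n ^+ 2) / 4 * keep S n * (x n.+1).1 <= (x n).1.
Proof.
move=> tx d0; have [_ _ ->] := tx n; rewrite d0.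
have [h1 h2 h3 h4] := slope_bounds n; have [h5 h6] := keep01 n.
have [_ /cell_box[u0 u1 _] _] := tx n.+1.
by rewrite /child /step /= !subr0 mul0r subr0 add0r; nra.
Qed.

Lemma trace_not_first d x n : trace d x -> (0 < d n)%N -> 1 / 8 <= (x n).1.
Proof.
move=> tx d0; have [dn cx ->] := tx n; have [h1 h2 h3 h4] := slope_bounds n.
have [h5 h6] := keep01 n; have [_ cx1 _] := tx n.+1.
have [u0 u1 _] := cell_box cx1.
have cx' : diamond (16 * slope S n) (x n.+1).
  have [h7 _ _ _] := slope_bounds n.+1; have := slope_noninc S n => h8.
  by apply: diamond_mono cx1; lra.
have [_ _ a _] := step_cone h1 h2 (ltW h5) h6 dn cx'.
have [_ b] := @vertex_cone _ _ 0 (d n) h1 h2 (leq0n _) (ltnW dn).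
have d1 : 1 <= (d n)%:R :> R by rewrite (ler_nat _ 1).
have c : 0 <= (1 + slope S n ^+ 2) / 8 * (shrink (keep S n) (x n.+1)).1.
  have su : 0 <= keep S n * (x n.+1).1 by rewrite mulr_ge0// ltW.
  by apply: mulr_ge0; rewrite ?/shrink /=; lra.
rewrite /= !subr0 in b; rewrite /child; lra.
Qed.

End Trace.

(** * Separation, flatness and expansion *)

Section Mirror.
Variable R : realType.

(** The generator is symmetric about its axis, so statements about left ends
    give those about right ends. *)
Definition mirror (u : R * R) : R * R := (1 - u.1, u.2).

Lemma step_mirror (t s : R) j u : (j < 4)%N ->
  step t s (3 - j) (mirror u) = mirror (step t s j u).
Proof.
by case: j => [|[|[|[|//]]]] _; apply/pair_equal_spec; split; rewrite /=; field.
Qed.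

Lemma diamond_mirror (c : R) u : diamond c u -> diamond c (mirror u).
Proof. by move=> /diamondP[h1 h2 h3 h4]; apply/diamondP; rewrite /= subKr. Qed.

End Mirror.

Section Separation.
Variables (R : realType) (S : schedule R).
Implicit Types (d e : nat -> nat) (x y : nat -> R * R) (k n : nat).

Lemma trace_mirror d x : trace S d x ->
  trace S (fun n => 3 - d n)%N (fun n => mirror (x n)).
Proof.
move=> tx n; have [dn cx ex] := tx n; split; first by rewrite ltnS leq_subr.
  exact: diamond_mirror.
by rewrite /child step_mirror// [in LHS]ex.
Qed.

(** Shrinking at level k keeps every point away from the left ends of its
    piece of level k, and hence of all its ancestors: along a leftmost
    branch the frames are aligned, so nothing is lost, and off that branch
    the distance is already of the order of the length of the ancestor. *)
Lemma trace_left_gap d x j k : trace S d x -> keep S k = 1 / 2 -> (j <= k)%N ->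
  len S k.+1 / 4 <= len S j * (x j).1.
Proof.
move=> tx sk jk; rewrite -(subKn jk); move: (k - j)%N (leq_subr j k) => i.
elim: i => [_|i IH ik].
  rewrite subn0; have [dn _ e] := tx k; have [h1 h2 h3 h4] := slope_bounds S k.
  have cx' : diamond (16 * slope S k) (x k.+1).
    have [_ + _] := tx k.+1; have [h7 _ _ _] := slope_bounds S k.+1.
    by have := slope_noninc S k => h8; apply: diamond_mono; lra.
  have h : (0 : R) <= 1 / 2 /\ (1 / 2 : R) <= 1 by lra.
  have [_ _ a _] := step_cone h1 h2 h.1 h.2 dn cx'.
  have [_ b] := @vertex_cone _ _ 0 (d k) h1 h2 (leq0n _) (ltnW dn).
  have -> : len S k.+1 / 4 = len S k * ((1 + slope S k ^+ 2) / 32).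
    by rewrite lenS sk; field.
  rewrite ler_pM2l ?len_gt0// e /child sk.
  have [_ /cell_box[u0 u1 _] _] := tx k.+1.
  have sh : 1 / 4 <= (shrink (1 / 2) (x k.+1)).1 by rewrite /shrink /=; lra.
  have c0 : 0 <= (1 + slope S k ^+ 2) / 8 by lra.
  have := ler_wpM2l c0 sh; rewrite /= !subr0 in b.
  have : 0 <= (d k)%:R / 8 :> R by rewrite divr_ge0.
  by lra.
have E : (k - i)%N = (k - i.+1).+1 by rewrite subnSK.
have := IH (ltnW ik); rewrite E => {}IH.
case: (posnP (d (k - i.+1)%N)) => d0.
  apply: le_trans IH _; rewrite lenS -[len S _ * _ * _]mulrA.
  by rewrite (ler_pM2l (len_gt0 S _)); exact: trace_first tx d0.
have := trace_not_first tx d0; rewrite -(ler_pM2l (len_gt0 S (k - i.+1))).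
have l1 : len S k.+1 <= len S (k - i.+1).+1 by apply: len_noninc; rewrite -E;
  lia.
by have l2 := len_half S (k - i.+1); lra.
Qed.

Lemma trace_right_gap d x j k : trace S d x -> keep S k = 1 / 2 -> (j <= k)%N ->
  len S k.+1 / 4 <= len S j * (1 - (x j).1).
Proof. by move=> tx; apply: trace_left_gap (trace_mirror tx). Qed.

Lemma trace_gap_lt d e x y n k : trace S d x -> trace S e y ->
  keep S k = 1 / 2 -> (n <= k)%N -> (d n < e n)%N ->
  len S k.+1 / 4 <= len S n * ((y n).1 - (x n).1).
Proof.
move=> tx ty sk nk de; have L0 := len_gt0 S n.
have lE : len S n * ((1 + slope S n ^+ 2) / 8 * keep S n) = len S n.+1 / 2.
  by rewrite lenS; field.
have [h1 h2 h3 h4] := slope_bounds S n; have [h5 h6] := keep01 S n.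
move: nk; rewrite leq_eqVlt => /predU1P[nk|nk].
  subst k; have [dn cx ex] := tx n; have [en cy ey] := ty n.
  have m u : cell S n.+1 u -> diamond (16 * slope S n) u.
    have [h7 _ _ _] := slope_bounds S n.+1; have := slope_noninc S n => h8.
    by apply: diamond_mono; lra.
  have cx1 : cell S n.+1 (x n.+1) by case: (tx n.+1).
  have cy1 : cell S n.+1 (y n.+1) by case: (ty n.+1).
  have [c r] := @step_lt _ _ (keep S n) _ _ _ _ h1 h2 (ltW h5) h6 de en (m _
    cx1) (m _ cy1).
  have -> : len S n.+1 / 4 = len S n * ((1 + slope S n ^+ 2) / 32).
    by rewrite lenS sk; field.
  rewrite ler_pM2l// ex ey /child.
  have /cell_box[u0 u1 _] := cx1; have /cell_box[v0 v1 _] := cy1.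
  have dee : 1 <= (e n)%:R - (d n)%:R :> R.
    by rewrite lerBrDl natr1 ler_nat.
  have sh : 1 / 2 <= 1 - (shrink (keep S n) (x n.+1)).1 + (shrink (keep S n) (y
    n.+1)).1.
    by rewrite sk /shrink /=; lra.
  have c0 : 0 <= (1 + slope S n ^+ 2) / 8 by lra.
  by have := ler_wpM2l c0 sh; lra.
have [_ r] := trace_lt tx ty de.
have a := trace_right_gap tx sk nk; have b := trace_left_gap ty sk nk.
apply: le_trans (_ : len S n * ((1 + slope S n ^+ 2) / 8 * keep S n *
    (1 - (x n.+1).1 + (y n.+1).1)) <= _).
  by rewrite [X in _ <= X]mulrA lE; lra.
rewrite ler_pM2l//; apply: le_trans r; rewrite lerDr divr_ge0//.
by rewrite subr_ge0 lerBrDl natr1 ler_nat.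
Qed.

(** Points separated at a level n <= k lie in different children, on both
    sides of a vertex, and by [trace_left_gap] each keeps its distance from
    that vertex even if no gap was made at level n. *)
Lemma trace_close_agree d e x y k : trace S d x -> trace S e y ->
  keep S k = 1 / 2 -> edist (x 0%N) (y 0%N) < len S k.+1 / 4 ->
  agree d e k.+1.
Proof.
move=> tx ty sk xy i ik; apply: contrapT => /first_difference[m [mi ag dm]].
have mk : (m <= k)%N by apply: leq_trans mi _.
suff : len S k.+1 / 4 <= edist (x 0%N) (y 0%N) by rewrite leNgt xy.
rewrite (agree_edist tx ty ag).
have [h|h|//] := ltngtP (d m) (e m).
- apply: le_trans (trace_gap_lt tx ty sk mk h) _.
  rewrite ler_pM2l ?len_gt0// edistC edistE; apply: le_trans (enorm_ge1 _).
  exact: ler_norm.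
- apply: le_trans (trace_gap_lt ty tx sk mk h) _.
  rewrite ler_pM2l ?len_gt0// edistE; apply: le_trans (enorm_ge1 _).
  exact: ler_norm.
Qed.

(** The numbers r n are the successive tails of the base-4 expansion of r 0
    with digits d. *)
Definition digits d (r : nat -> R) : Prop :=
  forall n, [/\ 0 <= r n, r n <= 1 & r n = ((d n)%:R + r n.+1) / 4].

(** A point whose parameter exceeds the left end by r is at distance at
    least of order r from the left end. Along the zero digits both
    quantities scale alike up to the growth of total length, which may drop
    temporarily; using its nondecreasing lower bound makes the induction go
    through. The error 4^-N stands for the unexamined tail of the address. *)
Lemma digits_left d x r N n : trace S d x -> digits d r ->
  growth_lb S n / 8 * (r n - 1 / 4 ^+ N) <= growth S n * (x n).1.
Proof.
move=> tx dr; elim: N n => [|N IH] n.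
  have [_ r1 _] := dr n; have [_ /cell_box[u0 _ _] _] := tx n.
  apply: le_trans (_ : 0 <= _); last by rewrite mulr_ge0// ltW// growth_gt0.
  rewrite expr0 divr1 pmulr_rle0 ?divr_gt0 ?growth_lb_gt0//; lra.
have := IH n.+1; have [r0 r1 rE] := dr n; have [r0' r1' _] := dr n.+1.
have [_ /cell_box[u0 _ _] _] := tx n; have [_ /cell_box[v0 _ _] _] := tx n.+1.
(* the claim at n.+1 is used only when the child is the leftmost one *)
have p4 : 0 < 1 / 4 ^+ N :> R by rewrite divr_gt0// exprn_gt0.
have -> : 1 / 4 ^+ N.+1 = 1 / 4 ^+ N / 4 :> R.
  by rewrite exprS; field; rewrite expf_neq0// pnatr_eq0.
move: (1 / 4 ^+ N) p4 => q q0 {}IH.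
have B0 := growth_lb_gt0 S n; have B1 := growth_lb_nondec S n;
  have BG := growth_lb_le S n.
case: (posnP (d n)) => d0.
  have := trace_first tx d0; rewrite -(ler_pM2l (growth_gt0 S n)).
  have -> : growth S n * ((1 + slope S n ^+ 2) / 4 * keep S n * (x n.+1).1) =
    growth S n.+1 * (x n.+1).1 / 4 by rewrite growthS; field.
  rewrite rE d0 => h; apply: le_trans h.
  have [qr|qr] := leP q (r n.+1); last first.
    have G0 : 0 <= growth S n.+1 * (x n.+1).1 by rewrite mulr_ge0// ltW//
      growth_gt0.
    have : 0 <= growth_lb S n * (q - r n.+1) by rewrite mulr_ge0 ?subr_ge0
      1?ltW.
    by lra.
  have h := ler_wpM2r (_ : 0 <= r n.+1 - q) B1.
  apply: le_trans (_ : (growth_lb S n.+1 / 8 * (r n.+1 - q)) / 4 <= _).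
    by have := h _; rewrite subr_ge0 qr => /(_ isT); lra.
  by rewrite ler_pM2r// invr_gt0.
have h := trace_not_first tx d0.
have := ler_wpM2l (ltW (growth_gt0 S n)) h.
have : 0 <= growth_lb S n * (1 - (r n - q / 4)) by rewrite mulr_ge0; lra.
by lra.
Qed.

Lemma digits_mirror d r : (forall n, (d n < 4)%N) -> digits d r ->
  digits (fun n => 3 - d n)%N (fun n => 1 - r n).
Proof.
move=> d4 dr n; have [r0 r1 rE] := dr n; split; try lra.
rewrite [in LHS]rE natrB; last by rewrite -ltnS.
by field.
Qed.

Lemma digits_left_le d x r n : trace S d x -> digits d r ->
  growth_lb S n / 8 * r n <= growth S n * (x n).1.
Proof.
move=> tx dr; apply/ler_addgt0Pl => e e0.
have B0 : 0 < growth_lb S n / 8 by rewrite divr_gt0 ?growth_lb_gt0.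
pose N := (Num.trunc (growth_lb S n / 8 / e)).+1.
have := @digits_left _ _ _ N n tx dr; rewrite mulrBr => h.
suff : growth_lb S n / 8 * (1 / 4 ^+ N) <= e by lra.
rewrite div1r ler_pdivrMr ?exprn_gt0// -ler_pdivrMl// mulrC.
apply: le_trans (ltW (truncnS_gt _)) _; rewrite -natrX ler_nat.
by rewrite ltnW// ltn_expl.
Qed.

Lemma digits_right_le d x r n : trace S d x -> digits d r ->
  growth_lb S n / 8 * (1 - r n) <= growth S n * (1 - (x n).1).
Proof.
move=> tx dr; have d4 i : (d i < 4)%N by case: (tx i).
exact: digits_left_le (trace_mirror tx) (digits_mirror d4 dr).
Qed.

(** Measure from the vertex between the two children to both sides with
    [digits_left_le] and [digits_right_le], and add the children in between. *)
Lemma digits_lt d e x y r q n : trace S d x -> trace S e y ->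
  digits d r -> digits e q -> (d n < e n)%N ->
  growth_lb S n / 16 * (q n - r n) <= growth S n * ((y n).1 - (x n).1).
Proof.
move=> tx ty dr eq de; have [_ H] := trace_lt tx ty de.
have [h1 h2 h3 h4] := slope_bounds S n; have [h5 h6] := keep01 S n.
have a := digits_right_le n.+1 tx dr; have b := digits_left_le n.+1 ty eq.
have B0 := growth_lb_gt0 S n; have B1 := growth_lb_nondec S n;
  have BG := growth_lb_le S n.
have [r0 r1 rE] := dr n; have [r0' r1' _] := dr n.+1.
have [q0 q1 qE] := eq n; have [q0' q1' _] := eq n.+1.
apply: le_trans (_ : growth S n * (((e n)%:R - (d n)%:R - 1) / 8 +
  (1 + slope S n ^+ 2) / 8 * keep S n * (1 - (x n.+1).1 + (y n.+1).1)) <= _);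
  last by rewrite ler_pM2l ?growth_gt0.
have dee : 0 <= (e n)%:R - (d n)%:R - 1 :> R.
  by rewrite subr_ge0 lerBrDl natr1 ler_nat.
have -> : growth S n * (((e n)%:R - (d n)%:R - 1) / 8 +
  (1 + slope S n ^+ 2) / 8 * keep S n * (1 - (x n.+1).1 + (y n.+1).1)) =
  growth S n * (((e n)%:R - (d n)%:R - 1) / 8) +
  growth S n.+1 / 8 * (1 - (x n.+1).1 + (y n.+1).1) by rewrite growthS; field.
rewrite rE qE.
have f1 : 0 <= growth_lb S n * ((e n)%:R - (d n)%:R - 1) by rewrite mulr_ge0//
  ltW.
have f2 := ler_wpM2r dee BG.
have r'0 : 0 <= 1 - r n.+1 by rewrite subr_ge0.
have f3 := ler_wpM2r r'0 B1; have f4 := ler_wpM2r q0' B1.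
have f5 := mulr_ge0 (ltW B0) r'0; have f6 := mulr_ge0 (ltW B0) q0'.
by lra.
Qed.

Lemma turn_agree d e n : agree d e n -> turn S d n = turn S e n.
Proof.
elim: n => [//|n IH] ag; rewrite /= (ag n)// IH// => i h; exact/ag/ltnW.
Qed.

Lemma digits_agree d e r q n : digits d r -> digits e q -> agree d e n ->
  r 0%N - q 0%N = (r n - q n) / 4 ^+ n.
Proof.
move=> dr eq; elim: n => [|n IH] ag; first by rewrite expr0 divr1.
rewrite IH; last by move=> i h; apply: ag; apply: ltnW.
have [_ _ ->] := dr n; have [_ _ ->] := eq n; rewrite (ag n)// exprS.
by field; rewrite expf_neq0// pnatr_eq0.
Qed.

(** Distances dominate parameter differences by a factor that tends to
    infinity with the number of common digits: this is where total length
    being infinite enters. *)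
Lemma digits_expand d e x y r q n : trace S d x -> trace S e y ->
  digits d r -> digits e q -> agree d e n ->
  growth_lb S n / 16 * `|r 0%N - q 0%N| <= edist (x 0%N) (y 0%N).
Proof.
move=> tx ty dr eq ag; have [ad|] := pselect (forall m, d m = e m).
  suff -> : r 0%N = q 0%N by rewrite subrr normr0 mulr0 edist_ge0.
  apply/eqP; rewrite -subr_eq0 -normr_le0; apply/ler_addgt0Pl => c c0.
  pose N := (Num.trunc c^-1).+1.
  rewrite addr0 (@digits_agree d e r q N)// normrM normfV [`|4 ^+ N|]ger0_norm
    ?exprn_ge0//.
  have [h0 h1 _] := dr N; have [h2 h3 _] := eq N.
  apply: le_trans (_ : 1 / 4 ^+ N <= _).
    rewrite ler_pM2r ?invr_gt0 ?exprn_gt0//.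
    by rewrite ler_norml; apply/andP; split; lra.
  rewrite div1r invf_ple ?posrE ?exprn_gt0//.
  apply: le_trans (ltW (truncnS_gt _)) _; rewrite -natrX ler_nat.
  by rewrite ltnW// ltn_expl.
move/existsNP => [m0 /first_difference[m [_ agm dm]]].
have nm : (n <= m)%N by rewrite leqNgt; apply/negP => /ag.
have bm : growth_lb S n <= growth_lb S m.
  elim: m nm {agm dm} => [|m IH]; first by rewrite leqn0 => /eqP ->.
  rewrite leq_eqVlt => /predU1P[->//|/IH h];
    exact: le_trans h (growth_lb_nondec S m).
rewrite (agree_edist tx ty agm) (digits_agree dr eq agm).
rewrite normrM normfV [`|4 ^+ m|]ger0_norm ?exprn_ge0//.
rewrite /len mulrA [X in _ <= X]mulrAC ler_pM2r ?invr_gt0 ?exprn_gt0//.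
apply: le_trans (_ : growth_lb S m / 16 * `|r m - q m| <= _).
  by rewrite ler_wpM2r// ler_pM2r// invr_gt0.
apply: le_trans (_ : growth S m * `|(y m).1 - (x m).1| <= _); last first.
  rewrite ler_pM2l ?growth_gt0// edistC edistE.
  exact: enorm_ge1 (y m - x m).
have G := growth_gt0 S m; have B := growth_lb_gt0 S m.
have [h|h|//] := ltngtP (d m) (e m).
- rewrite distrC; have := digits_lt tx ty dr eq h => h1.
  have [z|z] := leP (r m) (q m).
    rewrite ger0_norm ?subr_ge0//; apply: le_trans h1 _.
    by rewrite ler_pM2l// ler_norm.
  exfalso; have [_ _ rE] := dr m; have [_ _ qE] := eq m.
  have [a1 a2 _] := dr m.+1; have [b1 b2 _] := eq m.+1.
  have : (d m)%:R + 1 <= (e m)%:R :> R by rewrite natr1 ler_nat.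
  by lra.
- have := digits_lt ty tx eq dr h => h1; rewrite [`|_ - (x m).1|]distrC.
  have [z|z] := leP (q m) (r m).
    rewrite ger0_norm ?subr_ge0//; apply: le_trans h1 _.
    by rewrite ler_pM2l// ler_norm.
  exfalso; have [_ _ rE] := dr m; have [_ _ qE] := eq m.
  have [a1 a2 _] := dr m.+1; have [b1 b2 _] := eq m.+1.
  have : (e m)%:R + 1 <= (d m)%:R :> R by rewrite natr1 ler_nat.
  by lra.
Qed.

Lemma trace_flat d e x y n : trace S d x -> trace S e y -> d n <> e n ->
  `|(y n).2 - (x n).2| <= 32 * slope S n * `|(y n).1 - (x n).1|.
Proof.
move=> tx ty de; have [h1 _ _ _] := slope_bounds S n.
have c0 : 0 <= 32 * slope S n by lra.
have [h|h|//] := ltngtP (d n) (e n).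
- have [c _] := trace_lt tx ty h; apply: le_trans c _.
  by rewrite ler_wpM2l// ler_norm.
- have [c _] := trace_lt ty tx h; rewrite distrC [`|_ - (x n).1|]distrC.
  by apply: le_trans c _; rewrite ler_wpM2l// ler_norm.
Qed.

(** Let n be the first level at which the ball meets two children of its
    piece. Any point w of the ball is then almost level with the centre in
    the frame of that piece: either they lie in different children, or some
    third point of the ball lies in another child than both. If there is no
    such level, the centre is the only point of the snowflake in the ball. *)
Lemma snowflake_flat : R_w_rho_delta_1 (snowflake S).
Proof.
move=> gamma /andP[g0 g1] y _.
(* 96 = 3 * 32: two cone relations, with horizontal distances rho and 2 rho *)
have [|K hK] := @slope_small _ S (gamma / 96); first by lra.
have [k [Kk sk]] := keep_half S K.
have Lk := len_gt0 S k.+1.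
exists (len S k.+1 / 4); split; first by lra.
move=> rho /andP[rho0 rhoL] x0 [_ [d [x [tx xx0]]]].
have d4 i : (d i < 4)%N by case: (tx i).
pose differ n := exists e w, [/\ trace S e w, edist x0 (w 0%N) < rho &
  d n <> e n].
(* the first level at which the ball meets two different children *)
have [n agn nflat] : exists2 n, (forall e w, trace S e w ->
    edist x0 (w 0%N) < rho -> agree d e n) &
    forall e w, trace S e w -> edist x0 (w 0%N) < rho ->
    len S n * `|(w n).2 - (x n).2| < gamma * rho.
  have [ex|nex] := pselect (exists n, `[<differ n>]); last first.
    have [|N hN] := @len_small _ S (gamma * rho); first by rewrite mulr_gt0.
    exists N => e w te wr.
      move=> i _; apply: contrapT => de; apply: nex; exists i; apply/asboolP.
      by exists e, w.
    apply: le_lt_trans (hN N (leqnn N)).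
    have [_ /cell_box[_ _ a] _] := tx N; have [_ /cell_box[_ _ b] _] := te N.
    have := len_gt0 S N; have := ler_normB (w N).2 (x N).2.
    by move=> h1 h2; nra.
  case: (ex_minnP ex) => n /asboolP[e1 [w1 [te1 wr1 de1]]] nmin.
  have ag e w : trace S e w -> edist x0 (w 0%N) < rho -> agree d e n.
    move=> te wr i; apply: contraTeq => /eqP de; rewrite -leqNgt nmin//.
    by apply/asboolP; exists e, w.
  exists n => // e w te wr.
  have L0 := len_gt0 S n.
  have kn : (k < n)%N.
    rewrite ltnNge; apply/negP => nk; apply: de1.
    apply: (trace_close_agree tx te1 sk) => //.
    by rewrite xx0; apply: lt_le_trans wr1 rhoL.
  have tn : slope S n < gamma / 96 by apply: hK; lia.
  have [t0 _ _ _] := slope_bounds S n.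
  have near f v : trace S f v -> edist x0 (v 0%N) < rho ->
      len S n * `|(v n).1 - (x n).1| < rho.
    move=> tf vr; have := vr; rewrite -xx0 (agree_edist tx tf (ag _ _ tf vr)).
    apply: le_lt_trans; rewrite ler_pM2l// edistC edistE.
    exact: enorm_ge1 (v n - x n).
  have a1 := near _ _ te1 wr1; have a2 := near _ _ te wr.
  have f1 := trace_flat tx te1 de1.
  have [ee|/eqP ee] := eqVneq (e n) (e1 n).
    have de : d n <> e n by rewrite ee.
    have f2 := trace_flat tx te de; have := ler_wpM2l (ltW L0) f2.
    have : 32 * slope S n * (len S n * `|(w n).1 - (x n).1|) <= 32 * slope S n
      * rho.
      by rewrite ler_wpM2l// ?ltW//; lra.
    have : slope S n * rho < gamma / 96 * rho by rewrite ltr_pM2r.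
    have := mulr_gt0 g0 rho0; lra.
  have f2 := trace_flat te1 te (fun h => ee (esym h)).
  have n1 : `|(w n).2 - (x n).2| <= `|(w n).2 - (w1 n).2| + `|(w1 n).2 - (x
    n).2|.
    by rewrite -{1}(subrK (w1 n).2 (w n).2) -addrA ler_normD.
  have n2 : `|(w n).1 - (w1 n).1| <= `|(w n).1 - (x n).1| + `|(w1 n).1 - (x
    n).1|.
    rewrite -{1}(subrK (x n).1 (w n).1) -addrA [`|(w1 n).1 - _|]distrC.
    exact: ler_normD.
  have m1 := ler_wpM2l (ltW L0) n1; have m2 := ler_wpM2l (ltW L0) n2.
  have m3 := ler_wpM2l (ltW L0) f1; have m4 := ler_wpM2l (ltW L0) f2.
  have c0 : 0 <= 32 * slope S n by lra.
  have m5 := ler_wpM2l c0 m2; have m6 := ler_wpM2l c0 (ltW a1).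
  have m7 := ler_wpM2l c0 (ltW a2).
  have : slope S n * rho < gamma / 96 * rho by rewrite ltr_pM2r.
  lra.
pose v := turn S d n.
exists (range (fun s : R => x0 + s *: v)); split.
- exists x0, v; split => // v0; have := enorm_turn S n d4; rewrite -/v v0.
  by rewrite /enorm /= expr0n /= addr0 sqrtr0 => h; have := len_gt0 S n;
    rewrite -h ltxx.
- by exists 0 => //; rewrite scale0r addr0.
move=> w0 [/= wr [e [w [te ew]]]]; rewrite -ew in wr *.
have tP := turnP te tx (fun i h => esym (agn _ _ te wr i h)).
pose s := (w n).1 - (x n).1.
rewrite /set_nbhd /= /dist_to_set.
apply: le_lt_trans (ereal_inf_lbound (_ : _ (edist (w 0%N) (x0 + s *: v))%:E))
  _.
  by exists (x0 + s *: v) => //; exists s.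
rewrite lte_fin edistE opprD addrA -xx0 tP.
have -> : turn S e n = v by apply: turn_agree => i h;
  rewrite -(agn _ _ te wr i h).
have -> : cmul v (w n - x n) - s *: v = cmul v (0, (w n).2 - (x n).2).
  by apply/pair_equal_spec; split; rewrite /s /= /GRing.scale /=; ring.
rewrite enorm_cmul (enorm_turn S n d4) /enorm /= expr0n /= add0r sqrtr_sqr.
exact: nflat te wr.
Qed.

End Separation.

(** * Compactness and existence of traces *)

Section Compact.
Variables (R : realType) (S : schedule R).

Lemma step_continuous (t s : R) j : continuous (step t s j).
Proof.
move=> u; pose v := vertex t j; pose a := edge t j.
have -> : step t s j = fun u =>
  (v.1 + (a.1 * ((1 - s) / 2 + s * u.1) - a.2 * (s * u.2)),
   v.2 + (a.2 * ((1 - s) / 2 + s * u.1) + a.1 * (s * u.2))) by [].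
have c1 : (fun u : R * R => u.1) @ u --> u.1 by exact: cvg_fst.
have c2 : (fun u : R * R => u.2) @ u --> u.2 by exact: cvg_snd.
apply: (@cvg_pair _ _ _ _ (nbhs _) (nbhs _)).
- apply: cvgD; first exact: cvg_cst.
  apply: cvgB; apply: cvgM; try exact: cvg_cst.
    by apply: cvgD; [exact: cvg_cst|apply: cvgM => //; exact: cvg_cst].
  by apply: cvgM => //; exact: cvg_cst.
- apply: cvgD; first exact: cvg_cst.
  apply: cvgD; apply: cvgM; try exact: cvg_cst.
    by apply: cvgD; [exact: cvg_cst|apply: cvgM => //; exact: cvg_cst].
  by apply: cvgM => //; exact: cvg_cst.
Qed.

Lemma closed_cone_like (f : R * R -> R) (g : R * R -> R) :
  continuous f -> continuous g -> closed [set u | f u <= g u].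
Proof.
move=> cf cg.
have -> : [set u | f u <= g u] = (fun u => g u - f u) @^-1` [set r | 0 <= r].
  by apply/seteqP; split => u /=; rewrite subr_ge0.
apply: closed_comp; last exact: closed_ge.
by move=> u _; apply: cvgB; [exact: cg|exact: cf].
Qed.

Lemma cell_compact k : compact (cell S k).
Proof.
have cD : closed (cell S k).
  rewrite /cell (_ : diamond _ =
    [set u | `|u.2| <= 16 * slope S k * u.1] `&`
    [set u | `|u.2| <= 16 * slope S k * (1 - u.1)]).
    have c1 : continuous (fun u : R * R => u.1) by move=> u; exact: cvg_fst.
    have c2 : continuous (fun u : R * R => `|u.2|).
      by move=> u; apply: (@cvg_norm _ _ _ _ _ (fun u : R * R => u.2));
        exact: cvg_snd.
    apply: closedI; apply: closed_cone_like => // u; apply: cvgM;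
      try exact: cvg_cst.
      exact: c1.
    by apply: cvgB; [exact: cvg_cst|exact: c1].
  by apply/seteqP; split => u; rewrite /diamond /cone /= !subr0 sub0r normrN.
apply: (@subclosed_compact _ _ (`[(0 : R), 1]%classic `*` `[(-1 : R),
  1]%classic) cD).
  by apply: compact_setX; exact: segment_compact.
move=> u /cell_box[u0 u1]; rewrite ler_norml => /andP[v0 v1].
by split; rewrite /= in_itv /=; apply/andP; split; lra.
Qed.

Let seqs := prod_topology (fun _ : nat => (R * R)%type).

Lemma child_closed n j :
  closed [set f : seqs | f n = child S n j (f n.+1)].
Proof.
pose g (f : seqs) : R * R := f n - child S n j (f n.+1).
have -> : [set f : seqs | f n = child S n j (f n.+1)] = g @^-1` [set 0].
  apply/seteqP; split => f /=; rewrite /g; first by move=> ->; rewrite subrr.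
  by move/eqP; rewrite subr_eq0 => /eqP.
apply: closed_comp;
  last exact/accessible_closed_set1/hausdorff_accessible/norm_hausdorff.
move=> f _; apply: cvgB; first exact: nbhs_filter.
  exact: (@proj_continuous nat (fun _ => (R * R)%type) n f).
apply: (@continuous_comp _ _ _ (fun f : seqs => f n.+1) (child S n j)).
  exact: (@proj_continuous _ _ n.+1 f).
exact: step_continuous.
Qed.

(** The traces form a closed subset of a product of compact cells, and the
    snowflake is its image under evaluation at level 0. *)
Lemma snowflake_compact : compact (snowflake S).
Proof.
pose K : set seqs := [set f | forall n, cell S n (f n)].
have cK : compact K.
  by apply: (@tychonoff _ (fun _ : nat => (R * R)%type)) => n;
    exact: cell_compact.
pose C : set seqs :=
  \bigcap_n \bigcup_(j < 4) [set f | f n = child S n j (f n.+1)].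
have cC : closed C.
  apply: closed_bigI => n _.
  apply: (@closed_bigcup _ nat); first exact: finite_II.
  by move=> j _; exact: child_closed.
have -> : snowflake S = (fun f : seqs => f 0%N) @` (K `&` C).
  apply/seteqP; split => z.
    move=> [d [x [tx <-]]]; exists x => //; split.
      by move=> n; case: (tx n).
    by move=> n _; have [dn _ e] := tx n; exists (d n).
  move=> [x [kx cx] <-].
  have /choice[d dP] : forall n, exists j,
    (j < 4)%N /\ x n = child S n j (x n.+1).
    by move=> n; have [j j4 /= e] := cx n I; exists j.
  by exists d, x; split => // n; have [? ?] := dP n; split.
apply: continuous_compact; last exact: compact_closedI.
by apply: continuous_subspaceT => f; exact: (@proj_continuous _ _ 0%N f).
Qed.

Fixpoint approx d m n : R * R :=
  if m is m'.+1 then child S n (d n) (approx d m' n.+1) else (0, 0).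

(** Finite approximations of the trace satisfy more and more of the defining
    equations, and a cluster point in the compact product satisfies them
    all. *)
Lemma trace_exists d : (forall n, (d n < 4)%N) -> exists x, trace S d x.
Proof.
move=> d4.
have cell0 n : cell S n (0, 0).
  by have [h _ _ _] := slope_bounds S n; apply/diamondP; split => /=; lra.
have appD m n : cell S n (approx d m n).
  by elim: m n => [|m IH] n //=; exact: child_cell.
pose K : set seqs := [set f | forall n, cell S n (f n)].
have cK : compact K.
  by apply: (@tychonoff _ (fun _ : nat => (R * R)%type)) => n;
    exact: cell_compact.
pose F (N : nat) : seqs := fun n => approx d (N - n) n.
have [|x [kx clx]] := cK (F @ \oo) _.
  by apply: (@nearW _ \oo) => N n; exact: appD.
exists x => n; split => //.
have := @child_closed n (d n) x; apply => B nB.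
apply: clx nB; exists n.+1 => // N /= nN.
by rewrite /F -(subnSK nN).
Qed.

Lemma digits_exist (y : R) : 0 <= y -> y < 1 ->
  exists d r, [/\ forall n, (d n < 4)%N, digits d r & r 0%N = y].
Proof.
move=> y0 y1.
pose r n := iter n (fun z : R => 4 * z - (Num.trunc (4 * z))%:R) y.
pose d n := Num.trunc (4 * r n).
have r01 n : 0 <= r n < 1.
  elim: n => [|n /andP[h0 h1]]; first by rewrite /r /= y0.
  have := @truncn_itv _ (4 * r n); rewrite mulr_ge0// => /(_ isT) /andP[a b].
  rewrite /r iterS -/(r n); apply/andP; split; first lra.
  by move: b; rewrite -natr1; lra.
exists d, r; split => // n; have /andP[h0 h1] := r01 n.
  by rewrite truncn_lt_nat ?mulr_ge0//; lra.
have E : r n.+1 = 4 * r n - (d n)%:R by [].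
by split => //; [exact: ltW|rewrite E; lra].
Qed.

End Compact.

(** * The snowflake *)

Section Properties.
Variables (R : realType) (S : schedule R).

Lemma growth_lb_mono m n : (m <= n)%N -> growth_lb S m <= growth_lb S n.
Proof.
elim: n => [|n IH]; first by rewrite leqn0 => /eqP ->.
rewrite leq_eqVlt => /predU1P[->//|/IH h];
  exact: le_trans h (growth_lb_nondec S n).
Qed.

(** A cluster consists of the points that share their first k + 1 digits,
    where k is a level of shrinking. *)
Lemma snowflake_clustered (r : R) : 0 < r ->
  exists l, [/\ 0 < l, l < r & clustered (snowflake S) 8 l].
Proof.
move=> r0; have [N hN] := len_small S r0; have [k [Nk sk]] := keep_half S N.
have L0 := len_gt0 S k.+1; have Lr := hN k.+1 (leq_trans Nk (leqnSn k)).
exists (len S k.+1 / 4); split; [lra|lra|].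
exists (fun p q => forall d x e y, trace S d x -> x 0%N = p ->
  trace S e y -> y 0%N = q -> agree d e k.+1); split.
- move=> p q _ _ pq d x e y tx xp ty yq.
  by apply: (trace_close_agree tx ty sk); rewrite xp yq.
- move=> p q z [d [x [tx xq]]] pq qz d1 x1 d2 x2 t1 x1p t2 x2z i ik.
  by rewrite (pq _ _ _ _ t1 x1p tx xq)//; apply: (qz _ _ _ _ tx xq t2 x2z).
- move=> p q [d [x [tx xp]]] [e [y [ty yq]]] h.
  have := agree_edist_le tx ty (h _ _ _ _ tx xp ty yq).
  by rewrite xp yq; lra.
Qed.

Lemma snowflake_not_sigma_finite : ~ H1_sigma_finite (snowflake S).
Proof.
have /choice[F FP] : forall y : R, exists p, 0 <= y < 1 ->
    exists d x r, [/\ trace S d x, x 0%N = p, digits d r & r 0%N = y].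
  move=> y; have [/andP[y0 y1]|no] := boolP (0 <= y < 1); last by exists (0, 0).
  have [d [r [d4 dr ry]]] := digits_exist y0 y1.
  have [x tx] := trace_exists S d4.
  by exists (x 0%N) => _; exists d, x, r.
apply: (@flat_parametrization_not_sigma_finite _ _ F).
  by move=> y /FP[d [x [r [tx xp _ _]]]]; exists d, x.
move=> eta eta0; have [k0 hk0] := growth_lb_unbounded S (16 / eta).
have [k [k0k sk]] := keep_half S k0; have L0 := len_gt0 S k.+1.
exists (len S k.+1 / 8); first by rewrite divr_gt0.
move=> y z /FP[d [x [r [tx <- dr <-]]]] /FP[e [w [q [tw <- eq <-]]]] le.
have ag : agree d e k.+1 by apply: (trace_close_agree tx tw sk); lra.
have := digits_expand tx tw dr eq ag.
have : 16 / eta <= growth_lb S k.+1.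
  by apply: le_trans hk0 _; apply: growth_lb_mono; apply: leq_trans k0k _.
move=> h1 h2; rewrite -ler_pdivrMl//; apply: le_trans h2.
rewrite ler_wpM2r// ler_pdivlMr//.
by move: h1; rewrite mulrC.
Qed.

Fixpoint code (d : nat -> nat) n : nat :=
  if n is n'.+1 then (code d n' * 4 + d n')%N else 0%N.

Lemma code_lt d n : (forall i, (d i < 4)%N) -> (code d n < 4 ^ n)%N.
Proof. by move=> d4; elim: n => [|n IH] //=; have := d4 n; rewrite expnS;
  lia. Qed.

Lemma code_inj d e n : (forall i, (d i < 4)%N) -> (forall i, (e i < 4)%N) ->
  code d n = code e n -> agree d e n.
Proof.
move=> d4 e4; elim: n => [|n IH] //= h i.
have dn := d4 n; have en := e4 n.
have h1 : code d n = code e n by lia.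
have h2 : d n = e n by lia.
by rewrite ltnS leq_eqVlt => /predU1P[->//|]; exact: IH.
Qed.

Lemma bernoulli_ineq (h : R) n : 0 <= h -> 1 + n%:R * h <= (1 + h) ^+ n.
Proof.
move=> h0; elim: n => [|n IH]; first by rewrite mul0r addr0 expr0.
rewrite exprS; apply: le_trans (_ : (1 + h) * (1 + n%:R * h) <= _); last first.
  by rewrite ler_pM2l// ltr_wpDr.
have : 0 <= n%:R * (h * h) by rewrite mulr_ge0// mulr_ge0.
by rewrite -natr1; lra.
Qed.

(** Write a = b^2; by Bernoulli's inequality b^-n grows at least linearly,
    so a^-n grows at least quadratically. *)
Lemma linear_geometric_small (a e : R) N : 0 < a -> a < 1 -> 0 < e ->
  exists2 n, (N <= n)%N & 2 * n.+1%:R * a ^+ n <= e.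
Proof.
move=> a0 a1 e0; pose b := Num.sqrt a.
have b0 : 0 < b by rewrite sqrtr_gt0.
have bb : b ^+ 2 = a by rewrite sqr_sqrtr// ltW.
have b1 : b < 1 by rewrite -(@ltr_pXn2r _ 2)// ?nnegrE ?ltW// bb expr1n.
pose h := b^-1 - 1; have h0 : 0 < h by rewrite subr_gt0 invf_gt1.
(* n >= 4 / (e h^2) gives 2 (n + 1) <= 4 n <= e (n h)^2 *)
pose n := maxn N.+1 (Num.trunc (4 / (e * h ^+ 2))).+1.
exists n; first by rewrite /n; lia.
have n1 : 1 <= n%:R :> R by rewrite (ler_nat _ 1) /n; lia.
have hn : 4 / (e * h ^+ 2) <= n%:R.
  apply: le_trans (ltW (truncnS_gt _)) _; rewrite ler_nat /n; exact: leq_maxr.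
have h20 : 0 < e * h ^+ 2 by rewrite mulr_gt0// exprn_gt0.
have nh : n%:R * h <= (b ^+ n)^-1.
  have := bernoulli_ineq n (ltW h0).
  have -> : 1 + h = b^-1 by rewrite /h addrC subrK.
  by rewrite exprVn; apply: le_trans; rewrite lerDr.
have pn : 0 < b ^+ n by rewrite exprn_gt0.
have k : n%:R * h * b ^+ n <= 1 by rewrite -ler_pdivlMr// div1r.
have k2 : (n%:R * h * b ^+ n) ^+ 2 <= 1.
  by rewrite expr_le1// !mulr_ge0// ltW.
rewrite -bb -exprM mulnC exprM.
have {}hn : 4 <= n%:R * (e * h ^+ 2) by rewrite -ler_pdivrMr.
rewrite -[n.+1%:R]natr1.
have q0 : 0 < (b ^+ n) ^+ 2 by rewrite exprn_gt0.
have s1 : 2 * (n%:R + 1) * (b ^+ n) ^+ 2 <= 4 * n%:R * (b ^+ n) ^+ 2.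
  by rewrite ler_pM2r//; lra.
apply: le_trans s1 _.
have n0 : 0 < n%:R :> R by lra.
have s2 : 4 * n%:R * (b ^+ n) ^+ 2 <= n%:R * (e * h ^+ 2) * n%:R * (b ^+ n) ^+
  2.
  by rewrite ler_pM2r// ler_pM2r.
apply: le_trans s2 _.
have -> : n%:R * (e * h ^+ 2) * n%:R * (b ^+ n) ^+ 2 = e * (n%:R * h * b ^+ n)
  ^+ 2.
  by ring.
by rewrite -[leRHS]mulr1 ler_pM2l.
Qed.

(** The quantity is at most (2 (n + 1) a^n)^s with a = 4^(1/s - 1) < 1. *)
Lemma piece_count_small (s e : R) N : 1 < s -> 0 < e ->
  exists2 n, (N <= n)%N & (4 ^ n)%:R * (2 * len S n) `^ s <= e.
Proof.
move=> s1 e0; have s0 : 0 < s by lra.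
pose b : R := 4 `^ s^-1; have b0 : 0 < b by rewrite powR_gt0.
have bs : b `^ s = 4 by rewrite -powRrM mulVf ?gt_eqF// powRr1.
have b4 : b / 4 < 1.
  rewrite ltr_pdivrMr// mul1r -ltr_ln ?posrE// ln_powR gtr_pMl ?invf_lt1//.
  by rewrite ln_gt0// (ltr_nat _ 1 4).
have m0 : 0 < Num.min e 1 by rewrite lt_min e0 ltr01.
have [n Nn hn] := @linear_geometric_small (b / 4) _ N (divr_gt0 b0 (ltr0n _ 4))
  b4 m0.
exists n => //.
have p4 : 0 < 4 ^+ n :> R by rewrite exprn_gt0.
set x := 2 * n.+1%:R * (b / 4) ^+ n in hn.
have x0 : 0 < x by rewrite mulr_gt0 ?mulr_gt0 ?ltr0n// exprn_gt0// divr_gt0.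
move: hn; rewrite le_min => /andP[xe x1].
apply: le_trans xe; apply: le_trans (_ : x `^ s <= _); last first.
  by apply: ge1r_powR; rewrite ?x0// ltW.
have -> : (4 ^ n)%:R = (b ^+ n) `^ s.
  by rewrite -(powR_mulrn n (ltW b0)) -powRrM mulrC powRrM bs powR_mulrn//
    natrX.
have L0 := len_gt0 S n.
have bn0 : 0 <= b ^+ n by rewrite exprn_ge0// ltW.
have l0 : 0 <= 2 * len S n by lra.
rewrite -powRM//; apply: (ge0_ler_powR (ltW s0)); rewrite ?nnegrE;
  [exact: mulr_ge0|exact: ltW|].
rewrite /x /len expr_div_n.
have -> : b ^+ n * (2 * (growth S n / 4 ^+ n)) = 2 * growth S n * (b ^+ n / 4
  ^+ n).
  by field; rewrite gt_eqF.
by rewrite ler_pM2r ?divr_gt0 ?exprn_gt0// ler_pM2l// growth_le.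
Qed.

Lemma snowflake_measure_gt1 (s : R) : 1 < s ->
  hausdorff_measure s (snowflake S) = 0%E.
Proof.
move=> s1; apply: hausdorff_finite_eq0; first lra.
move=> r e r0 e0; have r20 : 0 < r / 2 by rewrite divr_gt0.
have [N hN] := len_small S r20.
have [n Nn hn] := piece_count_small N s1 e0.
exists (4 ^ n)%N, (fun i => [set p | exists d x, [/\ trace S d x, x 0%N = p &
  code d n = i]]), (2 * len S n).
have L0 := len_gt0 S n; split => //; last 2 first.
- by lra.
- by have := hN n Nn; lra.
- move=> p [d [x [tx xp]]]; exists (code d n) => /=.
    by apply: code_lt => i; case: (tx i).
  by exists d, x.
- move=> i; apply: ediam_ub; first by lra.
  move=> p q [d [x [tx <- dc]]] [e1 [y [ty <- ec]]].
  apply: (agree_edist_le tx ty); apply: code_inj; last by rewrite dc ec.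
    by move=> j; case: (tx j).
  by move=> j; case: (ty j).
Qed.

Lemma snowflake_measure1_infty : ~ (hausdorff_measure 1 (snowflake S) < +oo)%E.
Proof.
move=> h; apply: snowflake_not_sigma_finite; exists (fun=> snowflake S);
  split => //.
by apply/seteqP; split => [x Ax|x [_ _]//]; exists 0%N.
Qed.

Lemma snowflake_dim : hausdorff_dim (snowflake S) = 1%E.
Proof.
apply/eqP; rewrite eq_le; apply/andP; split.
  apply/lee_addgt0Pr => e e0; apply: ereal_inf_lbound; exists (1 + e) => //.
  by split; [lra|apply: snowflake_measure_gt1; lra].
apply: le_ereal_inf_tmp => _ [s [s0 hs] <-]; rewrite lee_fin leNgt;
  apply/negP => s1.
by apply: snowflake_measure1_infty; rewrite (hausdorff_le1_eq0 s0 (ltW s1) hs).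
Qed.

End Properties.

Theorem theorem2p9 (R : realType) :
  exists A : set (R * R),
    compact A /\
    R_w_rho_delta_1 A /\
    hausdorff_dim A = 1%E /\
    (~ weakly_locally_finite A /\ ~ strongly_locally_finite A) /\
    ~ H1_sigma_finite A /\
    purely_unrectifiable1 A.
Proof.
pose S := schedule_exists R; exists (snowflake S).
have cS : compact (snowflake S) := @snowflake_compact R S;
  have nS := @snowflake_not_sigma_finite R S.
split; first exact: cS.
split; first exact: snowflake_flat.
split; first exact: snowflake_dim.
split; last first.
  split; first exact: nS.
  apply: (@clustered_purely_unrectifiable _ _ 8) => // r.
  exact: snowflake_clustered.
split; first by move=> /(weakly_locally_finite_sigma cS).
move=> /(_ _ cS); rewrite setIid; exact: snowflake_measure1_infty.
Qed.
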